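(* Let $\langle X_n:n<\omega\rangle$ be a sequence of Polish spaces and let $\bar{\mathcal{I}}=\langle \mathcal{I}_n:n<\omega\rangle$ be a sequence such that each $\mathcal{I}_n$ is a $\boldsymbol{\Pi}^1_1$ on $\boldsymbol{\Sigma}^1_1$ $\sigma$-ideal on $X_n$ generated by closed sets. If $A\subseteq\prod_{n<\omega}X_n$ is $\boldsymbol{\Sigma}^1_1$, then either $A\in\bigotimes_{n<\omega}\mathcal{I}_n$, or else $A$ contains an $\bar{\mathcal{I}}$-positive $\mathbf{G}_\delta$ cube.
   Context: A $\sigma$-ideal on $X$ is a family of subsets of $X$ closed under subsets and countable unions; it is generated by closed sets if each of its members is covered by countably many closed members; it is $\boldsymbol{\Pi}^1_1$ on $\boldsymbol{\Sigma}^1_1$ if for every analytic $A\subseteq X^2$ the set $\{x\in X: A_x\in\mathcal{I}\}$ is coanalytic. A set is $\mathcal{I}$-positive if it is not in $\mathcal{I}$, and $\mathcal{I}$-full if its complement is in $\mathcal{I}$. For $D\subseteq\prod_{k<\omega}X_k$ and $n<\omega$, $\pi_{\omega,n}[D]\subseteq\prod_{k<n}X_k$ is the projection of $D$ to the first $n$ coordinates, $\pi_{\omega,\omega}[D]=D$. For $x=(x_0,\ldots,x_{n-1})\in\prod_{k<n}X_k$ and $B\subseteq\prod_{k<n+1}X_k$, $B_x=\{y\in X_n: (x_0,\ldots,x_{n-1},y)\in B\}$. For $n=0$ the convention is that $(\pi_{\omega,1}[D])_x$ means $\pi_{\omega,1}[D]\subseteq X_0$ and the corresponding requirement below is always imposed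 (even if $D=\emptyset$). $D\subseteq\prod_{k<\omega}X_k$ is an $\bar{\mathcal{I}}$-positive cube if (i) for each $n<\omega$ and each $x\in\pi_{\omega,n}[D]$ the set $(\pi_{\omega,n+1}[D])_x$ is $\mathcal{I}_n$-positive, and (ii) for each $x\in\prod_{k<\omega}X_k$: $x\in D$ iff $x\upharpoonright n\in\pi_{\omega,n}[D]$ for all $n<\omega$. It is an $\bar{\mathcal{I}}$-full cube if in addition in (i) the sets $(\pi_{\omega,n+1}[D])_x$ are $\mathcal{I}_n$-full. An $\bar{\mathcal{I}}$-positive $\mathbf{G}_\delta$ cube is an $\bar{\mathcal{I}}$-positive cube $D$ such that $\pi_{\omega,\beta}[D]$ is a $\mathbf{G}_\delta$ subset of $\prod_{k<\beta}X_k$ for every $\beta\leq\omega$. A set $B\subseteq\prod_{k<\omega}X_k$ belongs to $\bigotimes_{n<\omega}\mathcal{I}_n$ iff there is an $\bar{\mathcal{I}}$-full cube $D\subseteq\prod_{k<\omega}X_k$ disjoint from $B$.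
   Formalization: Each σ-ideal is additionally assumed proper (X_n is not in I_n); if some I_n contains X_n, there are no Ī-positive cubes and hence no Ī-full cubes, so both alternatives fail for every A. *)

(* Defs.v *)
From HB Require Import structures.
From mathcomp Require Export all_boot all_order all_algebra.
From mathcomp Require Export all_classical all_reals all_analysis.
From mathcomp Require Export borel_hierarchy.

Set Implicit Arguments.
Unset Strict Implicit.
Unset Printing Implicit Defensive.

Local Open Scope classical_set_scope.

(* The library's [completeType] is not used because it is pointed, whereas a
   Polish space may be empty.  [R] is only the codomain of the distances. *)
Definition complete_metric (R : realType) (M : metricType R) : Prop :=
  forall u : nat -> M, cauchy (u @ \oo) -> exists l : M, u @ \oo --> l.

Definition completely_metrizable (R : realType) (T : topologicalType) : Prop :=
  exists M : metricType R, complete_metric M /\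
    exists (f : T -> M) (g : M -> T),
      [/\ continuous f, continuous g, cancel f g & cancel g f].

Definition separable_space (T : topologicalType) : Prop :=
  exists2 D : set T, countable D & dense D.

Definition polish (R : realType) (T : topologicalType) : Prop :=
  separable_space T /\ completely_metrizable R T.

Definition analytic (R : realType) (X : topologicalType) (A : set X) : Prop :=
  exists Y : topologicalType, polish R Y /\
    exists2 f : Y -> X, continuous f & range f = A.

Definition coanalytic (R : realType) (X : topologicalType) (A : set X) : Prop :=
  analytic R (~` A).

(* The union of the empty family is included, so that [I set0] holds;
   properness is not part of the definition. *)
Definition sigma_ideal (T : Type) (I : set (set T)) : Prop :=
  (forall A B : set T, A `<=` B -> I B -> I A) /\
  (forall C : set (set T), countable C -> C `<=` I -> I (\bigcup_(A in C) A)).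

Definition generated_by_closed (T : topologicalType) (I : set (set T)) : Prop :=
  forall A, I A -> exists C : set (set T),
    [/\ countable C, (forall F, C F -> closed F /\ I F)
      & A `<=` \bigcup_(F in C) F].

Definition Pi11_on_Sigma11 (R : realType) (T : topologicalType)
    (I : set (set T)) : Prop :=
  forall A : set (T * T)%type,
    analytic R A -> coanalytic R [set x | I (xsection A x)].

Definition ideal_positive (T : Type) (I : set (set T)) (A : set T) : Prop := ~ I A.

Definition ideal_full (T : Type) (I : set (set T)) (A : set T) : Prop := I (~` A).

Section Cubes.
Variable X : nat -> topologicalType.

Definition omega_prod := prod_topology X.

Definition fin_prod (n : nat) := prod_topology (fun k : 'I_n => X k).

Definition fin_restrict (n : nat) (x : omega_prod) : fin_prod n :=
  fun k => x k.
Arguments fin_restrict : clear implicits.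

Definition projection (n : nat) (D : set omega_prod) : set (fin_prod n) :=
  fin_restrict n @` D.
Arguments projection : clear implicits.

(* [fin_init z] and [fin_last z] are the components of [z] under the identification of
   the product of X_0, ..., X_n with (product of X_0, ..., X_(n-1)) * X_n. *)
Definition fin_init (n : nat) (z : fin_prod n.+1) : fin_prod n :=
  fun k => z (widen_ord (leqnSn n) k).

Definition fin_last (n : nat) (z : fin_prod n.+1) : X n := z ord_max.

Definition fiber (n : nat) (B : set (fin_prod n.+1)) (x : fin_prod n) :
    set (X n) :=
  [set fin_last z | z in B `&` [set z | fin_init z = x]].

Variable I : forall n, set (set (X n)).
Arguments I : clear implicits.

(* The disjunct [n = 0] imposes the requirement on the projection of [D] to X_0
   even if [D] is empty. *)
Definition fiberwise (P : forall n, set (set (X n)))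
    (D : set omega_prod) : Prop :=
  forall (n : nat) (x : fin_prod n), n = 0%N \/ projection n D x ->
    P n (fiber (projection n.+1 D) x).

Definition positive_cube (D : set omega_prod) : Prop :=
  fiberwise (fun n => [set A | ideal_positive (I n) A]) D /\
  (forall x, D x <-> forall n, projection n D (fin_restrict n x)).

Definition full_cube (D : set omega_prod) : Prop :=
  positive_cube D /\ fiberwise (fun n => [set A | ideal_full (I n) A]) D.

Definition positive_Gdelta_cube (D : set omega_prod) : Prop :=
  [/\ positive_cube D, (forall n, Gdelta (projection n D)) & Gdelta D].

Definition ideal_product : set (set omega_prod) :=
  [set B | exists2 D, full_cube D & D `&` B = set0].

End Cubes.

(* Main.v *)
Require Import Defs.
From HB Require Import structures.

Set Implicit Arguments.
Unset Strict Implicit.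
Unset Printing Implicit Defensive.

Local Open Scope classical_set_scope.

(** Write [A] as the range of a continuous [f : Y -> omega_prod X] with [Y]
Polish, and name the points of [Y] by sequences of naturals (addresses in a
countable base).  Consider the game in which, at round [n], player One plays a
set of [I n] and player Two answers with a point [x n] outside of it and with a
natural [v n]; Two has to keep [x] and [v] consistent with some [y] of address
[v] and [f y = x].  This game is closed for Two.

If One wins, then his answers do not really depend on [v]: for a given [x]
there are countably many finite sequences of naturals, so the union of the
corresponding answers is still in the ideal, and avoiding this union at every
round gives a full cube that misses [A] ([lost_full_cube]).

Otherwise there is a set [W] of positions, containing the initial one, in which
Two can stay forever: at each position of [W] the points [x n] that lead back
to [W] form an [I n]-positive set ([game_dichotomy]).  Nothing is known about
the definability of [W], so choosing positive sections along [W] yields a cube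
that need not be a G_delta.  The remedy is to describe the future of a position
by a code, a sequence of finite data all whose requirements can be tested on
finite approximations.

A code at round [n] is a tree of basic open sets of [X n].  A node of length
[k] carries a basic open set, the information of order [k] on the code of the
next position, a closed set of [X n], and a certificate that this closed set is
positive.  Such certificates exist because the hypothesis
[Pi11_on_Sigma11] makes positivity of closed sets an analytic condition on
their codes ([positive_rep]).  Since a node of length [k] only refers to
shorter nodes of the next codes, all positions of [W] receive codes by one
simultaneous recursion on [k] ([assignment_ex]).

Which children a node receives is the matter of [children], a relative of
Solecki's theorem that positive analytic sets contain positive G_delta sets.
It has two cases.  Remove from the current positive set its relatively open
parts that are in the ideal: does the closure of the rest contain a positive
closed set that is nowhere dense in it?

Limits of codes of positions satisfy the same requirements ([limit_good]), and
a code that satisfies them determines a G_delta subset of [X n], which is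
positive by a Baire category argument that uses that [I n] is generated by
closed sets ([section_positive]).  A point of this set picks out one node of
each length, and the finite data at these nodes converge to a code for round
[n.+1] ([next_ex]).  Iterating, one obtains a cube.  Codes depend continuously
on the point, so the cube and its projections are G_delta
([cube_positive_Gdelta]).  Every point of the cube is approximated by positions
of [W] ([cube_approx]), so it is in the range of [f] ([consistent_limit]). *)

(** * Countable bases of Polish spaces *)

(** A countable base together with a notion of size, from which the metric
has been eliminated.  [small k j] stands for a diameter bound that decreases
with [k]; order 0 imposes no bound, so that the whole space, [B 0], can be the
root of the trees of basic open sets built below. *)
Record scheme (T : topologicalType) (B : nat -> set T)
    (small : nat -> nat -> Prop) : Prop := Scheme {
  scheme_top : B 0 = setT;
  scheme_open : forall j, open (B j);
  small0 : forall j, small 0 j;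
  smallW : forall k l j, (k <= l)%N -> small l j -> small k j;
  scheme_refine : forall (x : T) (U : set T) k, open U -> U x ->
    exists j, [/\ B j x, closure (B j) `<=` U & small k j];
  scheme_shrink : forall (x : T) (U : set T), open U -> U x ->
    exists k, forall j, small k j -> B j x -> B j `<=` U;
  scheme_complete : forall J : nat -> nat,
    (forall m, closure (B (J m.+1)) `<=` B (J m)) ->
    (forall m, small m (J m)) -> (forall m, B (J m) !=set0) ->
    exists x, forall m, B (J m) x }.

Section MetricSpaces.
Import Order.TTheory GRing.Theory Num.Theory.

Lemma metric_ball_nbhs (R : realType) (M : metricType R) (a y : M) (r : R) :
  (mdist a y < r)%R -> nbhs y [set z | (mdist a z < r)%R].
Proof.
move=> ar; apply/nbhs_ballP; exists (r - mdist a y)%R => /=.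
  by rewrite subr_gt0.
move=> z; rewrite ballEmdist /= => yz.
apply: (le_lt_trans (metric_triangle a y z)).
by rewrite -ltrBrDl.
Qed.

Lemma small_radius (R : realType) (k : nat) (e : R) : (0 < e)%R ->
  exists2 r : nat, (k <= r)%N & (r.+1%:R^-1 < e)%R.
Proof.
move=> e0; exists (k + Num.truncn e^-1)%N; first by rewrite leq_addr.
rewrite -[ltRHS]invrK ltf_pV2 ?posrE ?invr_gt0 ?ltr0n//.
apply: (lt_le_trans (truncnS_gt _)).
by rewrite ler_nat ltnS leq_addl.
Qed.

(** The basic sets are the balls of radius [1 / (r + 1)] around the points
of a countable dense set, and [small k] bounds the radius by [1 / (k + 1)]. *)
Lemma polish_scheme (R : realType) (T : topologicalType) : polish R T ->
  exists (B : nat -> set T) (small : nat -> nat -> Prop), scheme B small.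
Proof.
case=> [[D cD dD] [M [Mc [f [g [cf cg fK gK]]]]]].
have /countable_injP[e einj] := cD.
pose rad (r : nat) : R := (r.+1%:R^-1)%R.
have rad0 r : (0 < rad r)%R by rewrite invr_gt0 ltr0n.
have radW k l : (k <= l)%N -> (rad l <= rad k)%R.
  by move=> kl; rewrite /rad lef_pV2 ?posrE ?ltr0n// ler_nat ltnS.
pose bal i r := [set y | exists2 d, D d /\ e d = i & (mdist (f d) (f y) < rad r)%R].
pose B j : set T := if j is j'.+1 then
  (if unpickle j' is Some (i, r) then bal i r else set0) else setT.
pose small k j := k = 0%N \/ exists i r : nat, j = (pickle (i, r)).+1 /\ (k <= r)%N.
have BE i r : B (pickle (i, r)).+1 = bal i r by rewrite /B pickleK.
have ball_pre (a y : T) (s : R) : (mdist (f a) (f y) < s)%R ->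
    nbhs y [set z | (mdist (f a) (f z) < s)%R].
  by move=> /metric_ball_nbhs; exact: cf.
have nbU (U : set T) x : open U -> U x ->
    exists2 s : R, (0 < s)%R & forall y, (mdist (f x) (f y) < s)%R -> U y.
  move=> oU Ux.
  have : nbhs (f x) (g @^-1` U).
    by apply: cg; rewrite fK; apply: open_nbhs_nbhs.
  move=> /nbhs_ballP[s /= s0 sU]; exists s => // y xy.
  by rewrite -(fK y); apply: sU; rewrite ballEmdist.
exists B, small; split.
- by [].
- case=> [|j]; first exact: openT.
  rewrite /B; case: unpickle => [[i r]|]; last exact: open0.
  rewrite openE => y [d [Dd ed] dy].
  by apply: filterS (ball_pre _ _ _ dy) => z dz; exists d.
- by left.
- move=> k l j kl [l0|[i [r [-> lr]]]].
    by left; apply/eqP; rewrite -leqn0 -l0.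
  by right; exists i, r; split=> //; exact: leq_trans kl lr.
- move=> x U k oU Ux; have [s s0 sU] := nbU U x oU Ux.
  have [r kr rs] := @small_radius R k (s / 2%:R / 2%:R)%R
    (divr_gt0 (divr_gt0 s0 (ltr0n _ 2)) (ltr0n _ 2)).
  have [d [/= xd Dd]] : [set z | (mdist (f x) (f z) < rad r)%R]^° `&` D !=set0.
    apply: dD; last exact: open_interior.
    by exists x; apply: ball_pre; rewrite mdistxx.
  move/interior_subset: xd => /= xd.
  exists (pickle (e d, r)).+1; rewrite BE; split; last by right; exists (e d), r.
    by exists d => //; rewrite metric_sym.
  move=> y cly; apply: sU.
  have [z [[d' [Dd' ed'] dz] /= yz]] : bal (e d) r `&`
      [set z | (mdist (f y) (f z) < rad r)%R] !=set0.
    by apply: cly; apply: ball_pre; rewrite mdistxx.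
  have dd : d' = d by apply: einj => //; rewrite inE.
  subst d'.
  apply: (le_lt_trans (metric_triangle _ (f d) _)).
  have s40 : (0 < s / 2%:R / 2%:R)%R by rewrite !divr_gt0.
  rewrite (splitr s); apply: ltrD.
    by apply: (lt_trans xd); rewrite [ltRHS]splitr ltr_wpDr// ltW.
  rewrite (splitr (s / 2%:R)).
  apply: (le_lt_trans (metric_triangle _ (f z) _)).
  by apply: ltrD; [exact: lt_trans dz rs|rewrite metric_sym; exact: lt_trans yz rs].
- move=> x U oU Ux; have [s s0 sU] := nbU U x oU Ux.
  have [r kr rs] := @small_radius R 1 (s / 2%:R)%R (divr_gt0 s0 (ltr0n _ 2)).
  exists r => j [r0|[i [r' [-> rr']]]]; first by rewrite r0 in kr.
  rewrite BE => -[d [Dd ed] dx] y [d' [Dd' ed'] dy].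
  have dd : d' = d by apply: einj; rewrite ?inE// ed ed'.
  subst d'; apply: sU; apply: (le_lt_trans (metric_triangle _ (f d) _)).
  rewrite (splitr s) ltrD// metric_sym.
    exact: lt_le_trans dx (le_trans (radW _ _ rr') (ltW rs)).
  by rewrite metric_sym; exact: lt_le_trans dy (le_trans (radW _ _ rr') (ltW rs)).
- move=> J Jcl Js Jn0.
  have [p pJ] : exists p : nat -> T, forall m, B (J m) (p m).
    by exists (fun m => projT1 (cid (Jn0 m))) => m; case: cid.
  have Jmono k m : (k <= m)%N -> B (J m) `<=` B (J k).
    elim: m => [|m IH]; first by rewrite leqn0 => /eqP ->.
    rewrite leq_eqVlt => /predU1P[->//|km].
    apply: subset_trans (IH km).
    by apply: subset_trans (Jcl m); exact: subset_closure.
  have [l ul] : exists l : M, (f \o p) m @[m --> \oo] --> l.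
    apply: Mc; apply: cauchy_exP => s s0.
    have [r kr rs] := @small_radius R 1 s s0.
    have [r0|[i [r' [JE rr']]]] := Js r; first by rewrite r0 in kr.
    have := pJ r; rewrite JE BE => -[d [Dd ed] _].
    exists (f d); exists r => // m /= rm; rewrite ballEmdist /=.
    have := Jmono _ _ rm _ (pJ m); rewrite JE BE => -[d' [Dd' ed'] dy].
    have dd : d' = d by apply: einj; rewrite ?inE// ed ed'.
    by subst d'; exact: lt_le_trans dy (le_trans (radW _ _ rr') (ltW rs)).
  have pl : p m @[m --> \oo] --> g l.
    have := cvg_comp _ _ ul (cg l).
    by apply: cvg_trans; apply: near_eq_cvg; near=> m; rewrite /= fK.
  exists (g l) => m; apply: Jcl => U /pl [N _ NU].
  exists (p (maxn N m.+1)); split; last by apply: NU => /=; rewrite leq_maxl.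
  by apply: Jmono (pJ _); rewrite leq_maxr.
Unshelve. all: by end_near. Qed.

Lemma polish_hausdorff (R : realType) (T : topologicalType) :
  polish R T -> hausdorff_space T.
Proof.
case=> _ [M [_ [f [g [cf cg fK gK]]]]] x y xy.
rewrite -(fK x) -(fK y); congr g; apply: metric_hausdorff => A B.
by move=> /cf fA /cf fB; have [z [Az Bz]] := xy _ _ fA fB; exists (f z).
Qed.

End MetricSpaces.

(** * Spaces of branches of trees *)

Definition tree_body (P : seq nat -> Prop) : Type :=
  {e : nat -> nat | forall m, P (mkseq e m)}.

HB.instance Definition _ P := gen_eqMixin (tree_body P).
HB.instance Definition _ P := gen_choiceMixin (tree_body P).

Section TreeBody.
Import Order.TTheory GRing.Theory Num.Theory.

Variables (R : realType) (P : seq nat -> Prop).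
Local Notation T := (tree_body P).

Lemma tree_body_diff (x y : T) : x <> y -> exists k, sval x k != sval y k.
Proof.
case: x y => [x xP] [y yP] xy; apply: contrapT => /forallNP h; apply: xy.
have e : x = y by apply/funext => k; move/negP/negPn/eqP: (h k).
by subst y; congr exist; exact: Prop_irrelevance.
Qed.

Definition tree_dist (x y : T) : R :=
  if pselect (x = y) is right ne then (ex_minn (tree_body_diff ne)).+1%:R^-1%R
  else 0%R.

Lemma tree_dist_ge x y k : sval x k <> sval y k ->
  (k.+1%:R^-1 <= tree_dist x y)%R.
Proof.
move=> xyk; rewrite /tree_dist; case: pselect => [e|ne]; first by rewrite e in xyk.
case: ex_minnP => m _ /(_ k) mk; rewrite lef_pV2 ?posrE ?ltr0n// ler_nat ltnS.
by apply: mk; apply/eqP.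
Qed.

(** The distance is the inverse of the rank of the first difference, so
that balls are the sets of branches with a given initial segment. *)
Lemma tree_dist_lt x y n :
  (tree_dist x y < n.+1%:R^-1)%R <-> forall i, (i <= n)%N -> sval x i = sval y i.
Proof.
split=> [xyn i i_n|xyn].
  apply: contrapT => /tree_dist_ge; apply/negP; rewrite -ltNge.
  by apply: (lt_le_trans xyn); rewrite lef_pV2 ?posrE ?ltr0n// ler_nat ltnS.
rewrite /tree_dist; case: pselect => [e|ne]; first by rewrite invr_gt0 ltr0n.
case: ex_minnP => m xym _; rewrite ltf_pV2 ?posrE ?ltr0n// ltr_nat ltnS ltnNge.
by apply/negP => mn; move/eqP: xym; apply; exact: xyn.
Qed.

Lemma tree_dist_ge0 x y : (0 <= tree_dist x y)%R.
Proof. by rewrite /tree_dist; case: pselect => // ne; rewrite invr_ge0 ler0n. Qed.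

Lemma tree_dist_refl x : tree_dist x x = 0%R.
Proof. by rewrite /tree_dist; case: pselect. Qed.

Lemma tree_dist_eq0 x y : tree_dist x y = 0%R -> x = y.
Proof.
rewrite /tree_dist; case: pselect => // ne /eqP.
by rewrite invr_eq0 pnatr_eq0.
Qed.

Lemma tree_dist_le x y (r : R) : (0 <= r)%R ->
  (forall k, sval x k <> sval y k -> (k.+1%:R^-1 <= r)%R) -> (tree_dist x y <= r)%R.
Proof.
move=> r0 H; rewrite /tree_dist; case: pselect => // ne.
by case: ex_minnP => m /eqP /H.
Qed.

Lemma tree_dist_sym x y : tree_dist x y = tree_dist y x.
Proof.
by apply/eqP; rewrite eq_le; apply/andP; split; apply: tree_dist_le;
  rewrite ?tree_dist_ge0// => k xy; apply: tree_dist_ge; exact/nesym.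
Qed.

Lemma tree_dist_triangle y x z :
  (tree_dist x z <= tree_dist x y + tree_dist y z)%R.
Proof.
apply: tree_dist_le => [|k xz]; first by rewrite addr_ge0// tree_dist_ge0.
have [xy|/tree_dist_ge xy] := pselect (sval x k = sval y k).
  by rewrite -[leLHS]add0r lerD ?tree_dist_ge0//; apply: tree_dist_ge; rewrite -xy.
by rewrite -[leLHS]addr0 lerD ?tree_dist_ge0.
Qed.
End TreeBody.

(** Indexing the body by [R] lets type inference find the ultrametric with
values in [R]. *)
Definition metric_tree_body (R : realType) (P : seq nat -> Prop) := tree_body P.
HB.instance Definition _ (R : realType) P := Choice.on (metric_tree_body R P).
HB.instance Definition _ (R : realType) P := isMetric.Build R (metric_tree_body R P)
  (@tree_dist_refl R P) (@tree_dist_eq0 R P) (@tree_dist_sym R P)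
  (@tree_dist_triangle R P).

Section TreePolish.
Import Order.TTheory GRing.Theory Num.Theory.

Variables (R : realType) (P : seq nat -> Prop).
Local Notation T := (metric_tree_body R P).

Lemma tree_nbhs (x : T) (U : set T) : nbhs x U <->
  exists n, forall y : T, (forall i, (i <= n)%N -> sval x i = sval y i) -> U y.
Proof.
split=> [/nbhs_ballP[e /= e0 eU]|[n nU]].
  have [r _ re] := @small_radius R 0 e e0; exists r => y xy; apply: eU.
  rewrite ballEmdist; apply: lt_trans re.
  by move/(tree_dist_lt R x y r).2 : xy.
apply/nbhs_ballP; exists (n.+1%:R^-1)%R => /=; first by rewrite invr_gt0 ltr0n.
by move=> y; rewrite ballEmdist => /(tree_dist_lt R x y n).1 /nU.
Qed.

(** Completing each node of the tree to a branch gives a countable dense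
set; a Cauchy sequence stabilizes in each coordinate, and the limit stays in
the body, which is a condition on initial segments. *)
Lemma tree_polish : polish R T.
Proof.
split.
  pose ext (s : seq nat) (x : T) := s = mkseq (sval x) (size s).
  pose D := [set x : T | exists s, ext s x /\ x = xget x [set y | ext s y]].
  pose pk s : option T := if pselect (exists y, ext s y) is left e then
    Some (projT1 (cid e)) else None.
  exists [set x | exists s, pk s = Some x].
    apply/countable_injP.
    exists (fun x => pickle (xget [::] [set s | pk s = Some x])) => x y.
    rewrite !inE => -[s sx] [t ty] /(pcan_inj pickleK) exy.
    have := @xgetPex _ [::] [set s | pk s = Some x] (ex_intro _ s sx).
    have := @xgetPex _ [::] [set s | pk s = Some y] (ex_intro _ t ty).
    by rewrite /= exy => -> [].
  move=> O [x Ox] oO.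
  have /tree_nbhs[n nO] := open_nbhs_nbhs (conj oO Ox).
  pose s := mkseq (sval x) n.+1.
  have sx : ext s x by rewrite /ext /s size_mkseq.
  have [y pky] : exists y, pk s = Some y.
    by rewrite /pk; case: pselect => [e|[]]; [eexists|exists x].
  exists y; split; last by exists s.
  apply: nO => i i_n.
  have ys : ext s y.
    by move: pky; rewrite /pk; case: pselect => // e [<-]; case: cid.
  have := congr1 (fun s => nth 0%N s i) ys.
  by rewrite /s size_mkseq !nth_mkseq// ltnS.
exists T; split; last by exists id, id; split=> // x; exact: cvg_id.
move=> u /cauchy_ballP cu.
have cuN n : exists N, forall m, (N <= m)%N -> forall i, (i <= n)%N ->
    sval (u m) i = sval (u N) i.
  have := cu (n.+1%:R^-1)%R; rewrite invr_gt0 ltr0n => /(_ isT).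
  move=> [[F G] /= [[N1 _ FN] [N2 _ GN]] H].
  exists (maxn N1 N2) => m mN; apply/(tree_dist_lt R).
  have := H (u m, u (maxn N1 N2)); rewrite /= ballEmdist; apply; split.
    by apply: FN => /=; apply: leq_trans mN; rewrite leq_maxl.
  by apply: GN => /=; rewrite leq_maxr.
have [N NP] := choice cuN.
pose l n := sval (u (N n)) n.
have lE m k : (forall i, (i < m)%N -> (N i <= k)%N) ->
    mkseq l m = mkseq (sval (u k)) m.
  move=> Nk; apply: (@eq_from_nth _ 0%N); rewrite !size_mkseq// => i im.
  by rewrite !nth_mkseq// /l -(NP _ k)//; exact: Nk.
have Nmax m : exists k, forall k', (k <= k')%N -> forall i, (i < m)%N -> (N i <= k')%N.
  elim: m => [|m [k IH]]; first by exists 0%N.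
  exists (maxn k (N m)) => k'; rewrite geq_max => /andP[kk' Nk'] i.
  by rewrite ltnS leq_eqVlt => /predU1P[->//|]; exact: IH.
have lP m : P (mkseq l m).
  have [k Nk] := Nmax m; rewrite (lE m k); last exact: Nk.
  exact: (svalP (u k)).
exists (exist _ l lP) => U /tree_nbhs[n nU].
have [k Nk] := Nmax n.+1.
exists k => // k' /= kk'; apply: nU => i i_n.
have := congr1 (fun s => nth 0%N s i) (lE n.+1 k' (Nk k' kk')).
by rewrite !nth_mkseq// ltnS.
Qed.
End TreePolish.

(** The form in which Polish spaces of branches are used: continuity of [h]
is expressed with initial segments, without a topology on its domain. *)
Lemma tree_image_analytic (R : realType) (X : topologicalType)
    (P : seq nat -> Prop) (h : (nat -> nat) -> X) (A : set X) :
  (forall e, (forall m, P (mkseq e m)) -> A (h e)) ->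
  (forall x, A x -> exists2 e, (forall m, P (mkseq e m)) & h e = x) ->
  (forall e, (forall m, P (mkseq e m)) -> forall U, open U -> U (h e) ->
    exists m, forall e', (forall m, P (mkseq e' m)) ->
      (forall i, (i < m)%N -> e i = e' i) -> U (h e')) ->
  analytic R A.
Proof.
move=> hA Ah hc; exists (metric_tree_body R P); split; first exact: tree_polish.
exists (fun x => h (sval x)).
  move=> x U; rewrite nbhsE => -[V [oV Vx] VU].
  have [m mV] := hc _ (svalP x) _ oV Vx.
  apply/tree_nbhs; exists m => y xy; apply: VU.
  by apply: mV => [|i im]; [exact: (svalP y)|apply: xy; exact: ltnW].
apply/seteqP; split=> [_ [x _ <-]|x /Ah [e eP ex]].
  exact: hA (svalP x).
by exists (exist _ e eP).
Qed.

(** * Certificates for the positivity of closed sets *)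

Definition agree (T : Type) (m : nat) (u v : nat -> T) :=
  forall i, (i < m)%N -> u i = v i.

Lemma agreeW (T : Type) m n (u v : nat -> T) :
  (m <= n)%N -> agree n u v -> agree m u v.
Proof. by move=> mn uv i im; apply: uv; exact: leq_trans mn. Qed.

Lemma hausdorff_sep (T : topologicalType) (x y : T) : hausdorff_space T ->
  x <> y -> exists U V : set T, [/\ open U, open V, U x, V y & U `&` V = set0].
Proof.
rewrite open_hausdorff => hT /eqP /hT [[U V]] /= [xU yV] [oU oV /eqP UV].
by exists U, V; split=> //; apply/set_mem.
Qed.

Section Address.
Variables (Y : topologicalType) (B : nat -> set Y) (small : nat -> nat -> Prop).
Hypothesis S : scheme B small.

(** An address of [y] is a sequence of indices of basic sets that shrink to
[y]; only the first [m] indices are constrained here.  Every [y] has an address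
([address_ex]), and a sequence all whose initial segments are addresses is an
address ([address_lim]): this is how analytic sets become projections of
bodies of trees. *)
Definition address (w : nat -> nat) (m : nat) (y : Y) : Prop :=
  forall i, (i < m)%N -> [/\ B (w i) y, small i (w i) &
    (i.+1 < m)%N -> closure (B (w i.+1)) `<=` B (w i)].

Lemma addressW w m n y : (m <= n)%N -> address w n y -> address w m y.
Proof.
move=> mn wy i im; have [? ? h] := wy i (leq_trans im mn); split=> // im'.
by apply: h; exact: leq_trans mn.
Qed.

Lemma address_agree w w' m y : agree m w w' -> address w m y -> address w' m y.
Proof.
move=> ww' wy i im; have [? ? h] := wy i im.
by rewrite -ww'//; split=> // im'; rewrite -ww'//; exact: h.
Qed.

Lemma address_ex (y : Y) : exists w, forall m, address w m y.
Proof.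
have step : forall (p : nat * nat), exists j, B p.2 y ->
    [/\ B j y, closure (B j) `<=` B p.2 & small p.1 j].
  move=> [k j]; have [Bjy|] := pselect (B j y); last by exists 0%N.
  have [j' ?] := scheme_refine S k (scheme_open S j) Bjy.
  by exists j'.
have [f fP] := choice step.
pose w := fix w i := if i is i'.+1 then f (i'.+1, w i') else 0%N.
have wy i : B (w i) y.
  elim: i => [|i IH] /=; first by rewrite (scheme_top S).
  by have [] := fP (i.+1, w i) IH.
exists w => m i _; split=> // [|_]; last by have [] := fP (i.+1, w i) (wy i).
case: i => [|i]; first exact: small0 S _.
by have [] := fP (i.+1, w i) (wy i).
Qed.

Lemma address_lim w : (forall m, exists y, address w m y) ->
  exists y, forall m, address w m y.
Proof.
move=> wy.
have wc m : closure (B (w m.+1)) `<=` B (w m).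
  by have [y wmy] := wy m.+2; have [] := wmy m (leqnSn _); auto.
have ws m : small m (w m) by have [y wmy] := wy m.+1; have [] := wmy m (leqnn _).
have [y yP] : exists y, forall m, B (w m) y.
  apply: (scheme_complete S) => // m.
  by have [y wmy] := wy m.+1; exists y; have [] := wmy m (leqnn _).
by exists y => m i im; split.
Qed.

Lemma address_nbhs w y U : (forall m, address w m y) -> open U -> U y ->
  exists m, forall y', address w m y' -> U y'.
Proof.
move=> wy oU Uy; have [k kP] := scheme_shrink S oU Uy.
exists k.+1 => y' wy'.
have [wky sk _] := wy k.+1 k (leqnn _).
have [wky' _ _] := wy' k (leqnn _).
exact: kP sk wky _ wky'.
Qed.

Hypothesis hausY : hausdorff_space Y.

(** A Cantor scheme: by removing countably many countable basic sets, one
finds two condensation points in each uncountable basic set, and separates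
them. *)
Lemma cantor_embedding : ~ countable [set: Y] ->
  exists h : (nat -> bool) -> Y, injective h /\
    forall k U, open U -> U (h k) ->
      exists m, forall k', agree m k k' -> U (h k').
Proof.
move=> uncY.
(* Points outside of [N] are the condensation points. *)
pose N := \bigcup_(i in [set i | countable (B i)]) B i.
have cN : countable N by apply: bigcup_countable => // i.
have step : forall (p : nat * nat), exists j : bool -> nat, ~ countable (B p.2) ->
    [/\ forall b, ~ countable (B (j b)),
        forall b, closure (B (j b)) `<=` B p.2, forall b, small p.1 (j b) &
        B (j true) `&` B (j false) = set0].
  move=> [k j]; have [cj|uj] := pselect (countable (B j)).
    by exists (fun=> 0%N).
  have [x [Bx Nx]] : (B j `\` N) !=set0.
    apply/set0P/eqP => BN0; apply: uj; apply: sub_countable cN.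
    apply: subset_card_le => x Bx; apply: contrapT => Nx.
    by have : (B j `\` N) x by []; rewrite BN0.
  have [y [[By Ny] xy]] : (B j `\` N) `&` [set y | x <> y] !=set0.
    apply/set0P/eqP => BN0; apply: uj.
    have cNx : countable (N `|` [set x]).
      by rewrite -bigcup2inE; apply: bigcup_countable => // -[|[|]] //= _;
        exact: countable1.
    apply: sub_countable cNx; apply: subset_card_le => y By.
    have [Ny|Ny] := pselect (N y); first by left.
    right; apply: contrapT => yx.
    suff : set0 y by [].
    by rewrite -BN0; split=> // xy; apply: yx.
  have [U [V [oU oV Ux Vy UV]]] := hausdorff_sep hausY xy.
  have unc i z : ~ N z -> B i z -> ~ countable (B i).
    by move=> Nz Bz ci; apply: Nz; exists i.
  have [j1 [j1x j1U sj1]] :=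
    scheme_refine S k (openI oU (scheme_open S j)) (conj Ux Bx).
  have [j2 [j2y j2V sj2]] :=
    scheme_refine S k (openI oV (scheme_open S j)) (conj Vy By).
  exists (fun b : bool => if b then j1 else j2) => _; split.
  - by case; [exact: unc j1x|exact: unc j2y].
  - by case=> z; [move=> /j1U[]|move=> /j2V[]].
  - by case.
  - rewrite -subset0 => z [/(@subset_closure _ _ _)/j1U[Uz _]].
    by move=> /(@subset_closure _ _ _)/j2V[Vz _]; rewrite -UV.
have [f fP] := choice step.
pose J (k : nat -> bool) := fix J m := if m is m'.+1 then f (m'.+1, J m') (k m') else 0%N.
have Ju k m : ~ countable (B (J k m)).
  elim: m => [|m IH] /=; first by rewrite (scheme_top S).
  by have [] := fP (m.+1, J k m) IH.
have Jc k m : closure (B (J k m.+1)) `<=` B (J k m).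
  by have [_ + _ _] := fP (m.+1, J k m) (Ju k m); apply.
have Js k m : small m (J k m).
  case: m => [|m]; first exact: small0 S _.
  by have [_ _ + _] := fP (m.+1, J k m) (Ju k m); apply.
have Jn k m : B (J k m) !=set0.
  by apply/set0P/eqP => B0; apply: (Ju k m); rewrite B0.
have Jag k k' m : agree m k k' -> J k m = J k' m.
  elim: m => //= m IH kk'; rewrite IH ?kk'//.
  by move=> i im; apply: kk'; exact: leqW.
have [h hP] := choice (fun k => scheme_complete S (Jc k) (Js k) (Jn k)).
exists h; split; last first.
  move=> k U oU Uk; have [m mP] := scheme_shrink S oU Uk.
  exists m => k' /Jag kk'; apply: (mP (J k m) (Js k m) (hP k m)).
  by rewrite kk'; exact: hP.
move=> k k' hkk'; apply/funext => n; elim/ltn_ind: n => n IH.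
have := hP k n.+1; have := hP k' n.+1; rewrite /= hkk' (@Jag k k' n)//.
have [_ _ _] := fP (n.+1, J k' n) (Ju k' n).
move=> /seteqP[+ _] => /(_ (h k')) /= dis.
by case: (k n) (k' n) => -[]// h1 h2; exfalso; apply: dis.
Qed.

End Address.

(** The closed set coded by [k]: the points all whose basic neighbourhoods
are allowed by [k].  If [k] is the set of basic sets that meet a closed set,
this is that closed set, but every [k] codes some closed set, so no condition
on [k] has to be preserved under limits. *)
Definition trace_set (X : Type) (B : nat -> set X) (k : nat -> bool) : set X :=
  [set x | forall j, B j x -> k j].

(** [T m k w] can be decided from the first [m] values of [k] and [w], so
[exists w, forall m, T m k w] is the projection of the body of a tree. *)
Definition tree_local (T : nat -> (nat -> bool) -> (nat -> nat) -> Prop) :=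
  forall m k k' w w', agree m k k' -> agree m w w' -> T m k w -> T m k' w'.

Section PositiveRep.
Variables (R : realType) (X : topologicalType) (I : set (set X)).
Variables (B : nat -> set X) (small : nat -> nat -> Prop).
Hypotheses (S : scheme B small) (pX : polish R X) (sI : sigma_ideal I).
Hypothesis (PI : Pi11_on_Sigma11 R I).

(** In a countable space positivity is witnessed by a single point, whose
number is [w 0]. *)
Lemma positive_countable : countable [set: X] ->
  exists T, tree_local T /\
    forall k, ~ I (trace_set B k) <-> exists w, forall m, T m k w.
Proof.
move=> /countable_injP[e einj].
(* Locality at order 0 forbids looking at [w 0], hence the first disjunct. *)
exists (fun m k w => m = 0%N \/ exists x, [/\ e x = w 0%N, ~ I [set x] &
  forall j, (j < m)%N -> B j x -> k j]); split.
  move=> m k k' w w' kk' ww' [->|[x [ex Ix xk]]]; first by left.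
  case: m kk' ww' xk => [|m] kk' ww' xk; first by left.
  right; exists x; split=> //; first by rewrite -ww'.
  by move=> j jm Bx; rewrite -kk'//; exact: xk.
move=> k; split=> [IK|[w wP]].
  have [x [Kx Ix]] : exists x, trace_set B k x /\ ~ I [set x].
    apply: contrapT => /forallNP h; apply: IK.
    have -> : trace_set B k = \bigcup_(A in [set [set x] | x in trace_set B k]) A.
      apply/seteqP; split=> [x Kx|x [A [y Ky <-]] ->//].
      by exists [set x] => //; exists x.
    apply: sI.2.
      apply: sub_countable (card_image_le _ _) _.
      by apply/countable_injP; exists e => x y _ _; apply: einj; rewrite inE.
    by move=> _ [x Kx <-]; apply: contrapT => Ix; apply: (h x).
  by exists (fun=> e x) => m; right; exists x; split=> // j _; exact: Kx.
have [//|[x [ex Ix _]]] := wP 1%N.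
move=> IK; apply: Ix; apply: sI.1 IK => _ -> j Bx.
have [//|[y [ey Iy yk]]] := wP j.+1.
have xy : x = y by apply: einj; rewrite ?inE// ex ey.
by apply: yk => //; rewrite -xy.
Qed.

(** [Pi11_on_Sigma11] concerns subsets of [X * X] only, so codes of closed
sets have to be represented by points of [X].  An embedding [h] of the Cantor
space does this: [A], the set of pairs [(h k, x)] with [x] in the closed set
coded by [k], is analytic, and its sections at the points [h k] are the coded
sets. *)
Lemma positive_uncountable : ~ countable [set: X] ->
  exists T, tree_local T /\
    forall k, ~ I (trace_set B k) <-> exists w, forall m, T m k w.
Proof.
move=> uX; have hX := polish_hausdorff pX.
have [h [hinj hc]] := cantor_embedding S hX uX.
pose A := [set z : X * X | exists2 k, h k = z.1 & trace_set B k z.2].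
have aA : analytic R A.
  (* A branch [e] codes both a sequence of bits [b e] and an address [J e]; the tree
  requires that the point of address [J e] lies in the closed set coded by [b e]. *)
  pose J (e : nat -> nat) i := (e i)./2.
  pose b (e : nat -> nat) i := odd (e i).
  pose good e m := [/\ forall i, (i < m)%N -> small i (J e i),
    forall i, (i < m)%N -> B (J e i) !=set0,
    forall i, (i.+1 < m)%N -> closure (B (J e i.+1)) `<=` B (J e i) &
    forall i l, (i < m)%N -> (l < m)%N -> B (J e i) `<=` B l -> b e l].
  pose P (s : seq nat) := good (nth 0%N s) (size s).
  have PE e m : P (mkseq e m) <-> good e m.
    have eE : agree m (nth 0%N (mkseq e m)) e by move=> i im; rewrite nth_mkseq.
    have JE i : (i < m)%N -> J (nth 0%N (mkseq e m)) i = J e i.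
      by move=> im; rewrite /J eE.
    have bE i : (i < m)%N -> b (nth 0%N (mkseq e m)) i = b e i.
      by move=> im; rewrite /b eE.
    rewrite /P size_mkseq; split=> -[g1 g2 g3 g4]; split.
    - by move=> i im; rewrite -JE//; exact: g1.
    - by move=> i im; rewrite -JE//; exact: g2.
    - by move=> i im; rewrite -!JE//; [exact: g3|exact: ltnW].
    - by move=> i l im lm; rewrite -JE// -bE//; exact: g4.
    - by move=> i im; rewrite JE//; exact: g1.
    - by move=> i im; rewrite JE//; exact: g2.
    - by move=> i im; rewrite !JE//; [exact: g3|exact: ltnW].
    - by move=> i l im lm; rewrite JE// bE//; exact: g4.
  have goodP e : (forall m, P (mkseq e m)) -> exists x, forall m, B (J e m) x.
    move=> eP; apply: (scheme_complete S) => m.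
    - by have /PE[_ _ + _] := eP m.+2; exact.
    - by have /PE[+ _ _ _] := eP m.+1; exact.
    - by have /PE[_ + _ _] := eP m.+1; exact.
  have [x0 _] : [set: X] !=set0.
    by apply/set0P/eqP => X0; apply: uX; rewrite X0.
  pose pt e := xget x0 [set x | forall m, B (J e m) x].
  have ptP e : (forall m, P (mkseq e m)) -> forall m, B (J e m) (pt e).
    by move=> /goodP; exact: xgetPex.
  have smP e m : (forall m, P (mkseq e m)) -> small m (J e m).
    by move=> /(_ m.+1)/PE[+ _ _ _]; exact.
  apply: (@tree_image_analytic _ _ P (fun e => (h (b e), pt e))).
  - move=> e eP; exists (b e) => //= l Bl.
    have [m mP] := scheme_shrink S (scheme_open S l) Bl.
    have /PE[_ _ _ g4] := eP (m + l).+1; apply: (g4 m l).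
    + by rewrite ltnS leq_addr.
    + by rewrite ltnS leq_addl.
    + by apply: mP; [exact: smP|exact: ptP].
  - move=> [u x] [k /= <- kx].
    have [w wx] := address_ex S x.
    exists (fun i => (k i + (w i).*2)%N).
      have JE i : J (fun i => (k i + (w i).*2)%N) i = w i.
        by rewrite /J half_bit_double.
      have bE i : b (fun i => (k i + (w i).*2)%N) i = k i.
        by rewrite /b oddD odd_double addbF; case: (k i).
      move=> m; apply/PE; split=> i.
      + by move=> im; rewrite JE; have [] := wx m i im.
      + by move=> im; rewrite JE; exists x; have [] := wx m i im.
      + by move=> im; rewrite !JE; have [_ _] := wx m i (ltnW im); exact.
      + move=> l im lm; rewrite JE bE => /(_ x) wl; apply: kx; apply: wl.
        by have [] := wx m i im.
    have bE : b (fun i => (k i + (w i).*2)%N) = k.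
      by apply/funext => i; rewrite /b oddD odd_double addbF; case: (k i).
    rewrite bE; congr pair.
    set e := (fun i => _); have xe : forall m, B (J e m) x.
      by move=> m; rewrite /J half_bit_double; have [] := wx m.+1 m (leqnn _).
    have pe : forall m, B (J e m) (pt e).
      by apply: (@xgetPex _ x0 [set x | forall m, B (J e m) x]); exists x.
    apply: contrapT => pex.
    have [U [V [oU oV Up Vx UV]]] := hausdorff_sep hX pex.
    have [m mP] := scheme_shrink S oU Up.
    have : (U `&` V) x; last by rewrite UV.
    split=> //; apply: (mP (J e m)) => //.
    by rewrite /J half_bit_double; have [] := wx m.+1 m (leqnn _).
  - move=> e eP U oU Ue.
    have [[U1 U2] [/= U1e U2e] UU] : nbhs (h (b e), pt e) U.
      exact: open_nbhs_nbhs.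
    move: U1e; rewrite nbhsE => -[V1 [oV1 V1e] VU1].
    move: U2e; rewrite nbhsE => -[V2 [oV2 V2e] VU2].
    have [m1 m1P] := hc _ _ oV1 V1e.
    have [m2 m2P] := scheme_shrink S oV2 V2e.
    exists (m1 + m2).+1 => e' e'P ee'; apply: UU; split=> /=.
      apply: VU1; apply: m1P => i im; rewrite /b ee'//.
      by apply: (leq_trans im); apply: leqW; rewrite leq_addr.
    apply/VU2/(m2P (J e m2)); [exact: smP|exact: ptP|].
    have -> : J e m2 = J e' m2 by rewrite /J ee'// ltnS leq_addl.
    exact: ptP.
have [Y [pY [g cg gE]]] := PI aA.
have xsE k : xsection A (h k) = trace_set B k.
  apply/seteqP; split=> [x|x kx].
    by rewrite /xsection /= inE => -[k' /= /hinj ->].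
  by rewrite /xsection /= inE; exists k.
have [BY [sY SY]] := polish_scheme pY.
(* [w] is an address of a [y] with [g y = h k]; up to order [m], [k] is only
   known approximately, hence [k']. *)
exists (fun m k w => exists y k', [/\ h k' = g y, agree m k k' & address BY sY w m y]).
split.
  move=> m k k' w w' kk' ww' [y [k1 [hk1 kk1 wy]]].
  exists y, k1; split=> //; last exact: address_agree wy.
  by move=> i im; rewrite -kk'// kk1.
move=> k; split=> [Ik|[w wP]].
  have : range g (h k) by rewrite gE /= xsE.
  move=> [y _ gy]; have [w wy] := address_ex SY y.
  by exists w => m; exists y, k.
have [m|y wy] := @address_lim _ _ _ SY w.
  by have [y [_ [_ _ ?]]] := wP m; exists y.
suff gy : g y = h k.
  have : range g (g y) by exists y.
  by rewrite gE gy /= xsE.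
apply: contrapT => gyk.
have [U [V [oU oV Uy Vk UV]]] := hausdorff_sep hX gyk.
have ogU : open (g @^-1` U) by apply: open_comp => // z _; exact: cg.
have [m1 m1P] := address_nbhs SY wy ogU Uy.
have [m2 m2P] := hc _ _ oV Vk.
have [y' [k' [hk' kk' wy']]] := wP (m1 + m2)%N.
have : (U `&` V) (h k'); last by rewrite UV.
split; last by apply: m2P; apply: agreeW kk'; rewrite leq_addl.
by rewrite hk'; apply: m1P; apply: addressW wy'; rewrite leq_addr.
Qed.

Lemma positive_rep : exists T, tree_local T /\
  forall k, ~ I (trace_set B k) <-> exists w, forall m, T m k w.
Proof.
have [] := pselect (countable [set: X]); first exact: positive_countable.
exact: positive_uncountable.
Qed.

End PositiveRep.

(** * Splitting a positive set *)

(** Successive choices in which each choice depends on the list of the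
previous ones, under an invariant of that list. *)
Lemma seq_select (C : Type) (Inv : seq C -> Prop) (P : seq C -> nat -> C -> Prop) :
  Inv [::] ->
  (forall l, Inv l -> exists c, P l (size l) c /\ Inv (rcons l c)) ->
  exists f : nat -> C, forall j, P (mkseq f j) j (f j).
Proof.
move=> I0 IS; have [c0 _] := IS _ I0.
have step l : exists c, Inv l -> P l (size l) c /\ Inv (rcons l c).
  have [/IS[c cP]|nI] := pselect (Inv l); first by exists c.
  by exists c0.
have [g gP] := choice step.
pose L := fix L n := if n is m.+1 then rcons (L m) (g (L m)) else [::].
have LI n : Inv (L n) by elim: n => //= n /gP[].
have Ls n : size (L n) = n by elim: n => //= n IH; rewrite size_rcons IH.
exists (fun n => g (L n)) => j.
have -> : mkseq (fun n => g (L n)) j = L j.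
  by elim: j => //= j IH; rewrite mkseqS IH.
by rewrite -{2}(Ls j); have [] := gP _ (LI j).
Qed.

Section Ideal.
Variables (X : topologicalType) (I : set (set X)).
Hypothesis sI : sigma_ideal I.

Lemma ideal_sub (A C : set X) : A `<=` C -> I C -> I A.
Proof. exact: sI.1. Qed.

Lemma ideal_bigcup (T : countType) (F : T -> set X) :
  (forall t, I (F t)) -> I (\bigcup_t F t).
Proof.
move=> IF; have -> : \bigcup_t F t = \bigcup_(A in range F) A.
  apply/seteqP; split=> [x [t _ Ftx]|x [_ [t _ <-] Ftx]]; last by exists t.
  by exists (F t) => //; exists t.
apply: sI.2 => [|_ [t _ <-]//].
by apply: sub_countable (card_image_le _ _) _; exact: countableP.
Qed.

Lemma ideal_setU (A C : set X) : I A -> I C -> I (A `|` C).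
Proof.
move=> IA IC; apply: (@ideal_sub _ (\bigcup_(b : bool) if b then A else C)).
  by move=> x [Ax|Cx]; [exists true|exists false].
by apply: ideal_bigcup => -[].
Qed.

Lemma ideal0 : I set0.
Proof.
by rewrite -(bigcup_set0 (fun A : set X => A)); apply: sI.2.
Qed.

Lemma positive_nonempty (A : set X) : ~ I A -> A !=set0.
Proof. by move=> nA; apply/set0P/eqP => A0; apply: nA; rewrite A0; exact: ideal0. Qed.

Variables (B : nat -> set X) (small : nat -> nat -> Prop).
Hypothesis S : scheme B small.

(** [A] without its relatively open parts that are in the ideal.  Only a set
of the ideal is removed, and every open set that meets what is left has a
positive trace on [A]. *)
Definition reduct (A : set X) : set X :=
  A `\` \bigcup_(j in [set j | I (A `&` B j)]) B j.

Definition hull (A : set X) := closure (reduct A).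

Lemma reduct_sub A : reduct A `<=` A. Proof. by move=> x []. Qed.

Lemma reduct_rest A : I (A `\` reduct A).
Proof.
apply: (@ideal_sub _ (\bigcup_j if pselect (I (A `&` B j)) then A `&` B j else set0)).
  move=> x [Ax /not_andP[//|/contrapT[j Ij Bj]]].
  by exists j => //; case: pselect.
by apply: ideal_bigcup => j; case: pselect => //= _; exact: ideal0.
Qed.

Lemma reduct_mono A C : A `<=` C -> reduct A `<=` reduct C.
Proof.
move=> sAC x [Ax nAx]; split; first exact: sAC.
move=> [j Ij Bj]; apply: nAx; exists j => //=.
by apply: ideal_sub Ij; apply: setSI.
Qed.

Lemma meets_reduct A U : ~ I (A `&` U) -> ~ I (reduct A `&` U).
Proof.
move=> nA IA; apply: nA; apply: ideal_sub (ideal_setU IA (reduct_rest A)).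
move=> x [Ax Ux]; have [rx|rx] := pselect (reduct A x); first by left.
by right.
Qed.

Lemma hull_meets A U : open U -> U `&` hull A !=set0 -> U `&` reduct A !=set0.
Proof.
move=> oU [x [Ux /(_ U)]]; rewrite setIC; apply.
exact: open_nbhs_nbhs.
Qed.

Lemma hull_positive A U : open U -> U `&` hull A !=set0 -> ~ I (A `&` U).
Proof.
move=> oU /(hull_meets oU)[x [Ux [Ax nx]]] IA; apply: nx.
have [j [jx jU _]] := scheme_refine S 0 oU Ux.
exists j => //=; apply: ideal_sub IA.
by apply: setIS; apply: subset_trans jU; exact: subset_closure.
Qed.

Lemma hull_pos A : ~ I A -> ~ I (hull A).
Proof.
move=> nA IA; apply: (@meets_reduct A setT); rewrite setIT//.
by apply: ideal_sub IA; exact: subset_closure.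
Qed.

Definition nowhere_dense_in (M K : set X) :=
  forall U, open U -> U `&` M !=set0 -> ~ (U `&` M `<=` K).

Definition thin (A K : set X) :=
  [/\ closed K, K `<=` hull A, nowhere_dense_in (hull A) K & ~ I K].

(** The closed set whose positivity a code certifies; the children of [A]
have to be dense in it. *)
Definition core (A : set X) : set X := xget (hull A) [set K | thin A K].

(** The closed set inside which the children of [A] have to be disjoint.
If the nowhere dense parts of the hull are negligible, children can only be
separated inside the hull, because the hull may be contained, locally, in the
boundary of a basic set; otherwise they are disjoint in the whole space. *)
Definition mesh (A : set X) : set X :=
  if pselect (exists K, thin A K) then setT else hull A.

Lemma coreP A : (thin A (core A) /\ mesh A = setT) \/
  [/\ ~ exists K, thin A K, core A = hull A & mesh A = hull A].
Proof.
rewrite /core /mesh; case: pselect => [e|ne]; [left|right]; split=> //.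
  by have := xgetPex (hull A) e.
by apply: xgetPN => K KP; apply: ne; exists K.
Qed.

Lemma core_pos A : ~ I A -> ~ I (core A).
Proof.
move=> nA; have [[[_ _ _ ?] _]//|[_ -> _]] := coreP A; exact: hull_pos.
Qed.

Lemma core_hull A : core A `<=` hull A.
Proof. by have [[[_ ? _ _] _]//|[_ -> _]] := coreP A. Qed.

Lemma hull_closure A : hull A `<=` closure A.
Proof. by apply: closureS; exact: reduct_sub. Qed.

Lemma hull_mesh A : hull A `<=` mesh A.
Proof. by have [[_ ->]|[_ _ ->]] := coreP A. Qed.

Section Children.
Variables (A : nat -> set X) (o k : nat).
Hypothesis AO : forall t, A t `<=` B o.
Local Notation AA := (\bigcup_t A t).
Hypothesis Apos : ~ I AA.
Local Notation C c := (A c.2 `&` B c.1).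

Let good (c : nat * nat) :=
  [/\ closure (B c.1) `<=` B o, small k c.1, ~ I (C c) & mesh (C c) `<=` mesh AA].

Let AAO : AA `<=` B o. Proof. by move=> x [t _ /AO]. Qed.

Let pos_piece (U : set X) : ~ I (AA `&` U) -> exists t, ~ I (A t `&` U).
Proof.
move=> nU; apply: contrapT => /forallNP h; apply: nU.
rewrite setI_bigcupl; apply: ideal_bigcup => t.
exact: contrapT (h t).
Qed.

Let meets_open (U : set X) : open U -> U `&` hull AA !=set0 ->
  (U `&` B o) `&` hull AA !=set0.
Proof.
move=> oU /(hull_meets oU)[x [Ux rx]]; exists x; split.
  by split=> //; apply: AAO; exact: reduct_sub rx.
exact: subset_closure.
Qed.

Let open_avoid (l : seq (nat * nat)) :
  open [set y | forall c, c \in l -> ~ closure (B c.1) y].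
Proof.
elim: l => [|a l IH].
  rewrite (_ : [set y | _] = setT); first exact: openT.
  by rewrite -subTset => y _ c; rewrite in_nil.
have -> : [set y | forall c, c \in a :: l -> ~ closure (B c.1) y] =
    (~` closure (B a.1)) `&` [set y | forall c, c \in l -> ~ closure (B c.1) y].
  apply/seteqP; split=> [y h|y [h1 h2] c]; last first.
    by rewrite inE => /predU1P[->|/h2].
  split; first by apply: h; rewrite mem_head.
  by move=> c cl; apply: h; rewrite inE cl orbT.
by apply: openI => //; apply: closed_openC; exact: closed_closure.
Qed.

(** Children accumulate at the thin set [K]: the closures of the children
chosen so far miss [K], so there is always room for one more near a given point
of [K], and it can be kept off [K] since [K] is nowhere dense in the hull. *)
Lemma children_thin : thin AA (core AA) -> mesh AA = setT ->
  exists c : nat -> nat * nat,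
    [/\ forall j, good (c j),
        forall i j, B (c i).1 `&` B (c j).1 `&` mesh AA !=set0 -> c i = c j &
        forall j, B j `&` core AA !=set0 -> B j `&` core (C (c j)) !=set0].
Proof.
set K := core AA => -[cK KM ndK nK] meshT.
pose Inv (l : seq (nat * nat)) := forall c, c \in l -> closure (B c.1) `&` K = set0.
pose P (l : seq (nat * nat)) j c := [/\ good c,
  forall c', c' \in l -> B c'.1 `&` B c.1 = set0 &
  B j `&` K !=set0 -> closure (B c.1) `<=` B j].
have [|l lI|c cP] := @seq_select _ Inv P; first by [].
  (* If the basic set does not meet [K] the child of that index is unconstrained, and
  any point of [K] may serve. *)
  pose U := if pselect (B (size l) `&` K !=set0) then B (size l) else setT.
  have oU : open U.
    by rewrite /U; case: pselect => h; [exact: scheme_open S _|exact: openT].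
  have [x [Ux Kx]] : U `&` K !=set0.
    by rewrite /U; case: pselect => //= h; rewrite setTI; exact: positive_nonempty.
  pose V := U `&` [set y | forall c, c \in l -> ~ closure (B c.1) y].
  have oV : open V by exact: openI oU (open_avoid l).
  have /(meets_open oV) Vmeets : V `&` hull AA !=set0.
    exists x; split; last exact: KM; split=> // c cl cx.
    by have /seteqP[+ _] := lI c cl; apply; split; [exact: cx|].
  have oVO : open (V `&` B o) by apply: openI => //; exact: scheme_open S _.
  have /existsNP[z /not_implyP[[[Vz Oz] Mz] nKz]] := ndK _ oVO Vmeets.
  have [i [iz iV si]] := scheme_refine S k (openI oVO (closed_openC cK))
    (conj (conj Vz Oz) nKz).
  have [t tP] : exists t, ~ I (A t `&` B i).
    apply: pos_piece; apply: hull_positive; first exact: scheme_open S _.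
    by exists z.
  exists (i, t); split; last first.
    move=> c; rewrite mem_rcons inE => /predU1P[->|/lI//].
    by rewrite -subset0 => y [/iV[_ ?] ?].
  split.
  - split=> //=; last by rewrite meshT.
    by move=> y /iV[[_ ?] _].
  - move=> c' c'l; rewrite -subset0 => y [c'y /(@subset_closure _ _ _)/iV].
    by move=> [[[_ /(_ c' c'l)+] _] _]; apply; exact: subset_closure.
  - by move=> h y /iV[[[+ _] _] _]; rewrite /U; case: pselect.
exists c; split.
- by move=> j; have [] := cP j.
- rewrite meshT => i j; rewrite setIT.
  wlog ij : i j / (i < j)%N.
    move=> H h; have [ij|ji|->//] := ltngtP i j; first exact: H.
    by apply/esym/H => //; rewrite setIC.
  have cij : c i \in mkseq c j by apply/mapP; exists i => //; rewrite mem_iota.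
  by have [_ /(_ _ cij) -> _ []] := cP j.
- move=> j jK; have [[_ _ npos _] _ /(_ jK) cj] := cP j.
  have [x xc] := positive_nonempty (core_pos npos).
  exists x; split=> //; apply: cj.
  by have := hull_closure (core_hull xc); apply: closureS => y [].
Qed.

(** If there is no thin set, one of the countably many pieces [A t] is
locally dense in the hull, in the strong sense that its traces on small open
sets are positive: otherwise their closures would be nowhere dense, hence in
the ideal.  Such a piece has no thin set either, so its core is its hull. *)
Lemma meager_piece (U : set X) : ~ (exists K, thin AA K) -> open U ->
  U `&` hull AA !=set0 -> exists c, [/\ good c, closure (B c.1) `<=` U,
    B c.1 `&` hull AA !=set0 & B c.1 `&` hull AA `<=` core (C c)].
Proof.
move=> nthin oU UM.
have oUO : open (U `&` B o) by apply: openI => //; exact: scheme_open S _.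
have /meets_reduct nred := hull_positive oUO (meets_open oU UM).
have [t tP] : exists t, ~ I (A t `&` (reduct AA `&` (U `&` B o))).
  apply: pos_piece; apply: contra_not nred; apply: ideal_sub.
  by move=> x [rx Ux]; split=> //; exact: reduct_sub.
set C0 := _ `&` _ in tP.
have C0red : C0 `<=` reduct AA by move=> x [_ []].
have C0AA : C0 `<=` AA by apply: subset_trans C0red _; exact: reduct_sub.
have [W [oW WM WC0]] : exists W, [/\ open W, W `&` hull AA !=set0 &
    W `&` hull AA `<=` hull C0].
  apply: contrapT => nW; apply: nthin; exists (hull C0); split.
  - exact: closed_closure.
  - exact: closureS (reduct_mono C0AA).
  - by move=> V oV VM VC; apply: nW; exists V.
  - exact: hull_pos.
have /(hull_meets oW)[z [Wz rz]] : W `&` hull C0 !=set0.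
  by have [x [Wx Mx]] := WM; exists x; split=> //; exact: WC0.
have Uz : (U `&` B o) z by have [[_ []]] := rz.
have [i [iz iW si]] := scheme_refine S k (openI oW oUO) (conj Wz Uz).
have Biz : B i `<=` closure (B i) by exact: subset_closure.
pose c := (i, t).
have zM : hull AA z by apply/subset_closure/C0red; exact: reduct_sub rz.
have key V : open V -> V `<=` B i -> V `&` hull AA !=set0 -> ~ I (C c `&` V).
  move=> oV Vi [x [Vx Mx]]; have : ~ I (C0 `&` V).
    apply: hull_positive => //; exists x; split=> //; apply: WC0; split=> //.
    by have /Vi/Biz/iW[] := Vx.
  apply: contra_not; apply: ideal_sub => y [[Aty _] Vy].
  by split=> //; split=> //; exact: Vi.
have CAA : C c `<=` AA by move=> x [Atx _]; exists t.
have nthinC : ~ exists K, thin (C c) K.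
  move=> [K [cK KC ndK nK]]; apply: nthin; exists K; split=> //.
    by apply: subset_trans KC _; apply: closureS; exact: reduct_mono.
  move=> V oV [x [Vx Mx]] VK; apply: (ndK V oV).
    by exists x; split=> //; apply/KC/VK.
  move=> y [Vy Cy]; apply: VK; split=> //.
  by move: Cy; apply: closureS; exact: reduct_mono.
have [[thinC _]|[_ coreC meshC]] := coreP (C c).
  by exfalso; apply: nthinC; exists (core (C c)).
have meshA : mesh AA = hull AA.
  by have [[thinA _]|[]//] := coreP AA; exfalso; apply: nthin; exists (core AA).
exists c; split.
- split=> //=; first by move=> x /iW[_ []].
    have := key (B i) (scheme_open S i) (fun x h => h) (ex_intro _ z (conj iz zM)).
    by rewrite -setIA setIid.
  rewrite -/(C c) meshC meshA; apply: closureS; exact: reduct_mono.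
- by move=> x /iW[_ []].
- by exists z.
- rewrite coreC => x [ix Mx] V; rewrite nbhsE => -[V' [oV' V'x] V'V].
  have oVi : open (V' `&` B i) by apply: openI => //; exact: scheme_open S _.
  have /meets_reduct/positive_nonempty[y [ry [V'y _]]] : ~ I (C c `&` (V' `&` B i)).
    by apply: key => //; exists x.
  by exists y; split=> //; exact: V'V.
Qed.

(** A maximal disjoint family inside the hull: either the given basic set
already meets a chosen child, which is then repeated, or a new child is found
in it. *)
Lemma children_fat : ~ (exists K, thin AA K) ->
  exists c : nat -> nat * nat,
    [/\ forall j, good (c j),
        forall i j, B (c i).1 `&` B (c j).1 `&` mesh AA !=set0 -> c i = c j &
        forall j, B j `&` core AA !=set0 -> B j `&` core (C (c j)) !=set0].
Proof.
move=> nthin.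
have [[thinA _]|[_ -> ->]] := coreP AA.
  by exfalso; apply: nthin; exists (core AA).
set M := hull AA.
pose good2 c := good c /\ B c.1 `&` M `<=` core (C c).
pose Inv (l : seq (nat * nat)) := forall c, c \in l -> good2 c.
pose P (l : seq (nat * nat)) j c := [/\ good2 c,
  c \in l \/ forall c', c' \in l -> B c'.1 `&` B c.1 `&` M = set0 &
  B j `&` M !=set0 -> B j `&` (B c.1 `&` M) !=set0].
have [|l lI|c cP] := @seq_select _ Inv P; first by [].
  pose U := if pselect (B (size l) `&` M !=set0) then B (size l) else setT.
  have oU : open U.
    by rewrite /U; case: pselect => h; [exact: scheme_open S _|exact: openT].
  have UM : U `&` M !=set0.
    rewrite /U; case: pselect => //= h; rewrite setTI.
    exact: positive_nonempty (hull_pos Apos).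
  have sU : B (size l) `&` M !=set0 -> U `<=` B (size l).
    by move=> h; rewrite /U; case: pselect => [h'|//]; exact: subset_refl.
  have [[c [cl cU]]|nc] := pselect (exists c, c \in l /\ U `&` (B c.1 `&` M) !=set0).
    have cg := lI c cl.
    exists c; split; last first.
      by move=> c'; rewrite mem_rcons inE => /predU1P[->//|/lI].
    split=> //; first by left.
    by move=> /sU UB; have [x [/UB ? ?]] := cU; exists x.
  have [c [cg cU cM cC]] := meager_piece nthin oU UM.
  have cU' : B c.1 `<=` U by apply: subset_trans cU; exact: subset_closure.
  exists c; split; last first.
    by move=> c'; rewrite mem_rcons inE => /predU1P[->//|/lI].
  split=> //.
    right=> c' c'l; apply/eqP/negPn/negP => /set0P[x [[c'x cx] Mx]].
    by apply: nc; exists c'; split=> //; exists x; split=> //; exact: cU'.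
  by move=> /sU UB; have [x [cx Mx]] := cM; exists x; split=> //; exact/UB/cU'.
exists c; split.
- by move=> j; have [[]] := cP j.
- suff H n i j : (i <= n)%N -> (j <= n)%N ->
      B (c i).1 `&` B (c j).1 `&` M !=set0 -> c i = c j.
    by move=> i j; apply: (H (maxn i j)); rewrite (leq_maxl, leq_maxr).
  elim: n i j => [|n IH] i j; first by rewrite !leqn0 => /eqP -> /eqP ->.
  wlog ij : i j / (i < j)%N.
    move=> H i_n jn h; have [ij|ji|->//] := ltngtP i j; first exact: H.
    by apply/esym/H => //; rewrite (setIC (B (c j).1)).
  move=> i_n jn h; have [_ [cjl|dis] _] := cP j.
    move: cjl => /mapP[m]; rewrite mem_iota add0n => /andP[_ mj] cjm.
    rewrite cjm; apply: IH; rewrite -?cjm//; rewrite -ltnS; exact: leq_trans jn.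
  have : c i \in mkseq c j by apply/mapP; exists i => //; rewrite mem_iota.
  by move/dis => h0; move: h; rewrite h0 => -[].
- move=> j jM; have [[_ cC] _ /(_ jM)[x [jx cx]]] := cP j.
  by exists x; split=> //; exact: cC.
Qed.

(** A positive set [AA], cut into countably many pieces [A t], has small
positive parts [C (c j)] of the pieces, separated from each other inside the
mesh, whose cores are dense in the core of [AA].  The density has a convenient
form: the child of index [j] takes care of the basic set of index [j]. *)
Lemma children : exists c : nat -> nat * nat,
    [/\ forall j, [/\ closure (B (c j).1) `<=` B o, small k (c j).1,
          ~ I (C (c j)) & mesh (C (c j)) `<=` mesh AA],
        forall i j, B (c i).1 `&` B (c j).1 `&` mesh AA !=set0 -> c i = c j &
        forall j, B j `&` core AA !=set0 -> B j `&` core (C (c j)) !=set0].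
Proof.
have [[thA mA]|[nthin _ _]] := coreP AA; first exact: children_thin.
exact: children_fat.
Qed.

End Children.
End Ideal.

(** * G_delta sets and cubes with prescribed sections *)

Lemma prod_continuous (T : topologicalType) (J : Type) (K : J -> topologicalType)
    (f : T -> prod_topology K) :
  (forall i, continuous (fun x => f x i)) -> continuous f.
Proof.
move=> fc x; apply/cvg_sup => i U [V [[W oW <-] Wfx] WU].
apply: filterS WU _; apply: (fc i x); exact: open_nbhs_nbhs.
Qed.

Section Gdelta.
Variable X : topologicalType.

Lemma Gdelta_bigcap (T : countType) (F : T -> set X) :
  (forall t, Gdelta (F t)) -> Gdelta (\bigcap_t F t).
Proof.
move=> GF; have /choice[G GP] : forall t, exists G : nat -> set X,
    (forall i, open (G i)) /\ F t = \bigcap_i G i.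
  by move=> t; have [G oG FG] := GF t; exists G.
exists (fun j => if unpickle j is Some (t, i) then G t i else setT).
  move=> j; case: unpickle => [[t i]|]; last exact: openT.
  by have [] := GP t.
apply/seteqP; split=> [x Fx j _|x Gx t _].
  case: unpickle => [[t i]|//]; have [_ FG] := GP t.
  by have := Fx t I; rewrite FG; apply.
have [_ ->] := GP t => i _.
by have := Gx (pickle (t, i)) I; rewrite /= pickleK.
Qed.

Lemma Gdelta_setI (A C : set X) : Gdelta A -> Gdelta C -> Gdelta (A `&` C).
Proof.
move=> GA GC; have -> : A `&` C = \bigcap_b (if b then A else C).
  by apply/seteqP; split=> [x [Ax Cx] [] _//|x h]; split; [exact: (h true)|exact: (h false)].
by apply: Gdelta_bigcap => -[].
Qed.

Lemma Gdelta_open_setU (V G : set X) : open V -> Gdelta G -> Gdelta (V `|` G).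
Proof.
move=> oV [F oF ->]; exists (fun i => V `|` F i).
  by move=> i; exact: openU.
apply/seteqP; split=> [x [Vx|Fx] i _|x h]; [by left|by right; exact: Fx|].
have [Vx|nVx] := pselect (V x); first by left.
by right=> i _; have [] := h i I.
Qed.

Lemma Gdelta_closed (B : nat -> set X) small (A : set X) :
  scheme B small -> closed A -> Gdelta A.
Proof.
move=> S cA.
exists (fun k => \bigcup_(j in [set j | small k j /\ A `&` B j !=set0]) B j).
  by move=> k; apply: bigcup_open => j _; exact: scheme_open S _.
apply/seteqP; split=> [x Ax k _|x h].
  have [j [jx _ sj]] := scheme_refine S k (@openT X) (I : setT x).
  by exists j => //; split=> //; exists x.
apply: contrapT => nAx.
have [k kP] := scheme_shrink S (closed_openC cA) nAx.
have [j [sj [y [Ay jy]]] jx] := h k I.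
exact: kP sj jx _ jy Ay.
Qed.

End Gdelta.

Lemma Gdelta_preimage (X Y : topologicalType) (f : X -> Y) (A : set Y) :
  continuous f -> Gdelta A -> Gdelta (f @^-1` A).
Proof.
move=> cf [F oF ->]; exists (fun i => f @^-1` (F i)); last by rewrite preimage_bigcap.
by move=> i; apply: open_comp => // x _; exact: cf.
Qed.

Section LocalCube.
Variable X : nat -> topologicalType.
Local Notation Om := (omega_prod X).

Definition same (n : nat) (x y : Om) := forall k, (k < n)%N -> x k = y k.

Lemma same_sym n x y : same n x y -> same n y x.
Proof. by move=> xy k kn; rewrite xy. Qed.

Lemma same_trans n y x z : same n x y -> same n y z -> same n x z.
Proof. by move=> xy yz k kn; rewrite xy// yz. Qed.

Lemma sameW m n x y : (m <= n)%N -> same n x y -> same m x y.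
Proof. by move=> mn xy k km; apply: xy; exact: leq_trans mn. Qed.

Definition upd (x : Om) (n : nat) (u : X n) : Om := dfwith x n u.

Lemma updE x n (u : X n) : upd x u n = u. Proof. exact: dfwithin. Qed.

Lemma upd_same x n (u : X n) : same n (upd x u) x.
Proof. by move=> k kn; rewrite /upd dfwithout// neq_ltn kn orbT. Qed.

Lemma fin_restrictP n (x y : Om) : @fin_restrict X n x = @fin_restrict X n y <-> same n x y.
Proof.
split=> [xy k kn|xy]; last by apply: functional_extensionality_dep => k; exact: xy.
by have := congr1 (fun z : fin_prod X n => z (Ordinal kn)) xy.
Qed.

Lemma proj_cont n : continuous (fun x : Om => x n).
Proof. exact: (@proj_continuous _ _ n). Qed.

Lemma open_coord n (U : set (X n)) : open U -> open [set x : Om | U (x n)].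
Proof. by move=> oU; apply: open_comp oU => x _; exact: proj_cont. Qed.

Variable P : forall n, Om -> set (X n).
Arguments P : clear implicits.
Hypothesis P_local : forall n x y, same n x y -> P n x = P n y.

Definition follows (n : nat) (x : Om) := forall k, (k < n)%N -> P k x (x k).

Definition local_cube : set Om := [set x | forall n, P n x (x n)].

Lemma follows_same n x y : same n x y -> follows n x -> follows n y.
Proof.
move=> xy fx k kn; rewrite -xy// (P_local (sameW (ltnW kn) (same_sym xy))).
exact: fx.
Qed.

Lemma followsS n x : follows n.+1 x <-> follows n x /\ P n x (x n).
Proof.
split=> [fx|[fx Px] k]; first by split=> [k kn|]; apply: fx => //; exact: ltnW.
by rewrite ltnS leq_eqVlt => /predU1P[->|/fx].
Qed.

Lemma follows_upd n x u : follows n x -> P n x u -> follows n.+1 (upd x u).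
Proof.
move=> fx Pu; apply/followsS; split.
  by apply: follows_same fx; apply: same_sym; exact: upd_same.
by rewrite updE (P_local (@upd_same x n u)).
Qed.

Hypothesis P_nonempty : forall n x, follows n x -> P n x !=set0.

(** Choose the coordinates from [n] on one after the other in the
nonempty prescribed sections. *)
Lemma cube_extend n x : follows n x -> exists2 y, local_cube y & same n y x.
Proof.
move=> fx.
pose z := fix z m := if m is m'.+1 then
  (if (m' < n)%N then z m' else upd (z m') (xget (z m' m') (P m' (z m')))) else x.
have zS m : same m (z m.+1) (z m).
  by rewrite /=; case: ifP => _; [|exact: upd_same].
have zmono m k : (m <= k)%N -> same m (z k) (z m).
  elim: k => [|k IH]; first by rewrite leqn0 => /eqP ->.
  rewrite leq_eqVlt => /predU1P[->//|mk].
  by apply: same_trans (IH mk); exact: sameW (zS k).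
have zx m : (m <= n)%N -> z m = x.
  by elim: m => //= m IH mn; rewrite mn IH// ltnW.
have zf m : (n <= m)%N -> follows m (z m).
  elim: m => [|m IH]; first by rewrite leqn0 => /eqP n0; rewrite zx ?n0// -n0.
  rewrite leq_eqVlt => /predU1P[<-|nm]; first by rewrite zx.
  rewrite /= ltnNge -ltnS nm /=; apply: follows_upd; first exact: IH.
  by apply: xgetPex; apply: P_nonempty; exact: IH.
pose y : Om := fun k => z k.+1 k.
have yz m : same m y (z m) by move=> k km; rewrite /y (@zmono k.+1 m).
exists y.
  move=> m; pose N := maxn n m.+1.
  have /(_ m) := @follows_same _ _ _ (same_sym (yz N)) (zf N (leq_maxl _ _)).
  by apply; rewrite leq_maxr.
by apply: same_trans (yz n) _; rewrite zx.
Qed.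

Lemma projection_cube n z :
  @projection X n local_cube z <-> exists2 x, follows n x & @fin_restrict X n x = z.
Proof.
split=> [[x Dx <-]|[x /cube_extend[y Dy yx] <-]].
  by exists x => // k _; exact: Dx.
by exists y => //; apply/fin_restrictP.
Qed.

Lemma fiber_cube n x : follows n x ->
  fiber (@projection X n.+1 local_cube) (@fin_restrict X n x) = P n x.
Proof.
move=> fx; apply/seteqP; split=> [u [z [/projection_cube[y fy <-] /= yx] <-]|u Pu].
  have xy : same n y x by apply/fin_restrictP.
  by have /followsS[_] := fy; rewrite (P_local xy).
exists (@fin_restrict X n.+1 (upd x u)); last by rewrite /fin_last /fin_restrict updE.
split; first by apply/projection_cube; exists (upd x u) => //; exact: follows_upd.
by apply/(@fin_restrictP n); exact: upd_same.
Qed.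

Lemma cube_fiberwise (Q : forall n, set (set (X n))) (x0 : Om) :
  (forall n x, follows n x -> Q n (P n x)) -> fiberwise Q local_cube.
Proof.
move=> QP n z [n0|/projection_cube[x fx <-]]; last by rewrite fiber_cube//; exact: QP.
subst n; have -> : z = @fin_restrict X 0 x0.
  by apply: functional_extensionality_dep => -[].
by rewrite fiber_cube//; exact: QP.
Qed.

Lemma cube_closed x :
  local_cube x <-> forall n, @projection X n local_cube (@fin_restrict X n x).
Proof.
split=> [Dx n|h n]; first by exists x.
have /projection_cube[y /followsS[_ Py] /fin_restrictP yx] := h n.+1.
by rewrite -yx// (P_local (sameW (leqnSn n) (same_sym yx))).
Qed.

(** Completing a point of the finite product with fixed coordinates is
continuous and turns the projection into the preimage of a set of the infinite
product, where all rounds can be treated in one space. *)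
Lemma projection_Gdelta (x0 : Om) n :
  Gdelta [set x | follows n x] -> Gdelta (@projection X n local_cube).
Proof.
pose ext (z : fin_prod X n) : Om := fun k =>
  if pselect (k < n)%N is left kn then z (Ordinal kn) else x0 k.
have extE z : @fin_restrict X n (ext z) = z.
  apply: functional_extensionality_dep => -[k kn]; rewrite /fin_restrict /ext /=.
  by case: pselect => // kn'; rewrite (bool_irrelevance kn' kn).
have cext : continuous ext.
  apply: prod_continuous => k; rewrite /ext; case: pselect => [kn|nk] x.
    exact: (@proj_continuous _ _ (Ordinal kn)).
  exact: cst_continuous.
move=> /(Gdelta_preimage cext); congr Gdelta; apply/seteqP; split=> [z fz|z].
  by apply/projection_cube; exists (ext z).
move=> /projection_cube[x fx xz]; apply: follows_same fx.
by apply/fin_restrictP; rewrite extE.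
Qed.

End LocalCube.

(** * The closed game *)

Section Game.
Variables (X : nat -> topologicalType) (I : forall n, set (set (X n))).
Local Notation Om := (omega_prod X).
Arguments I : clear implicits.
Hypothesis sI : forall n, sigma_ideal (I n).
Hypothesis I_proper : forall n, ~ I n setT.
Variables (Y : topologicalType) (BY : nat -> set Y) (smY : nat -> nat -> Prop).
Hypothesis SY : scheme BY smY.
Variable f : Y -> Om.

Definition consistent (n : nat) (x : Om) (v : nat -> nat) :=
  exists y, address BY smY v n y /\ same n (f y) x.

Definition successors (W : nat -> Om -> (nat -> nat) -> Prop) n x v : set (X n) :=
  [set u | exists x' v', [/\ same n x' x, agree n v' v, x' n = u & W n.+1 x' v']].

(** Player Two can remain in [W] forever: whatever set of the ideal is
played, some successor in [W] avoids it. *)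
Definition winning (W : nat -> Om -> (nat -> nat) -> Prop) :=
  forall n x v, W n x v -> consistent n x v /\ ~ I n (successors W x v).

Definition strategy := forall k, Om -> (nat -> nat) -> set (X k).

(** A strategy of player One may look at the position reached so far, that
is, at the coordinates below [k]. *)
Definition legal (s : strategy) := (forall k x v, I k (s k x v)) /\
  (forall k x x' v v', same k x x' -> agree k v v' -> s k x v = s k x' v').

Definition beats (s : strategy) n x v := forall x' v',
  same n x' x -> agree n v' v -> (forall k, (n <= k)%N -> ~ s k x' v' (x' k)) ->
  exists k, ~ consistent k x' v'.

Definition lost n x v := exists2 s, legal s & beats s n x v.

Lemma consistent_same n x x' v v' : same n x x' -> agree n v v' ->
  consistent n x v -> consistent n x' v'.
Proof.
move=> xx' vv' [y [vy fy]]; exists y; split; first exact: address_agree vy.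
exact: same_trans fy xx'.
Qed.

Lemma legal_trivial : legal (fun k _ _ => set0).
Proof. by split=> // k _ _; exact: ideal0 (sI k). Qed.

(** If all but an ideal set [S] of the next points lead to lost positions
only, player One plays [S] first and then follows the strategy chosen for the
successor that is reached.  Gluing strategies in this way replaces the ordinal
ranks of the usual proof that open games are determined. *)
Lemma lost_of_successors n x v :
  I n (successors (fun n x v => ~ lost n x v) x v) -> lost n x v.
Proof.
set S := successors _ x v => IS.
pose vupd a : nat -> nat := fun i => if i == n then a else v i.
have /choice[t tP] : forall ua : X n * nat, exists s, legal s /\
    (~ S ua.1 -> beats s n.+1 (upd x ua.1) (vupd ua.2)).
  move=> [u a]; have [Su|nSu] := pselect (S u).
    by exists (fun k _ _ => set0); split=> //; exact: legal_trivial.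
  have [s ls bs] : lost n.+1 (upd x u) (vupd a).
    apply: contrapT => nl; apply: nSu; exists (upd x u), (vupd a); split=> //.
    - exact: upd_same.
    - by move=> i i_n; rewrite /vupd ltn_eqF.
    - exact: updE.
  by exists s.
(* The guard makes [s] legal also at positions that do not extend [(x, v)]. *)
pose s : strategy := fun k x' v' =>
  if (n < k)%N then t (x' n, v' n) k x' v' else
  if pselect [/\ k = n, same n x' x & agree n v' v] is left _ then
    successors (fun n x v => ~ lost n x v) x' v' else set0.
exists s.
  split=> [k x' v'|k x' x'' v' v'' xx vv]; rewrite /s.
    case: ifP => _; first by have [[]] := tP (x' n, v' n).
    case: pselect => [[kn xx' vv']|_]; last exact: ideal0 (sI k).
    subst k; apply: (ideal_sub (sI n)) IS => u [x1 [v1 [xx1 vv1 u1 l1]]].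
    exists x1, v1; split=> //; first exact: same_trans xx1 xx'.
    by move=> i i_n; rewrite vv1// vv'.
  case: ifP => nk.
    by rewrite xx// vv//; have [[_ loc] _] := tP (x'' n, v'' n); exact: loc.
  case: pselect => [[kn xx' vv']|h]; case: pselect => [[kn2 xx2 vv2]|h2] //.
  - apply/seteqP; split=> u [x1 [v1 [xx1 vv1 u1 l1]]]; exists x1, v1; split=> //.
    + exact: same_trans xx1 xx.
    + by move=> i ik; rewrite vv1// vv.
    + by apply: same_trans xx1 _; exact: same_sym.
    + by move=> i ik; rewrite vv1// vv.
  - exfalso; apply: h2; split=> //; subst k.
      by apply: same_trans xx'; exact: same_sym.
    by move=> i i_n; rewrite -vv// vv'.
  - exfalso; apply: h; split=> //; subst k; first exact: same_trans xx xx2.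
    by move=> i i_n; rewrite vv// vv2.
move=> x' v' xx' vv' av.
have nS : ~ S (x' n).
  have := av n (leqnn n); rewrite /s ltnn; case: pselect => [h|[]//].
  apply: contra_not => -[x1 [v1 [xx1 vv1 u1 l1]]]; exists x1, v1; split=> //.
    by apply: same_trans xx1 _; exact: same_sym.
  by move=> i i_n; rewrite vv1// vv'.
have [_ /(_ nS)] := tP (x' n, v' n); apply.
- move=> k /=; rewrite ltnS leq_eqVlt => /predU1P[->|kn]; first by rewrite updE.
  by rewrite upd_same// xx'.
- move=> i /=; rewrite ltnS leq_eqVlt => /predU1P[->|i_n]; first by rewrite /vupd eqxx.
  by rewrite /vupd ltn_eqF// vv'.
- by move=> k nk; have := av k (ltnW nk); rewrite /s nk.
Qed.

Lemma not_lost_winning : winning (fun n x v => ~ lost n x v).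
Proof.
move=> n x v nl; split; last by apply: contra_not nl; exact: lost_of_successors.
apply: contrapT => nc; apply: nl; exists (fun k _ _ => set0).
  exact: legal_trivial.
move=> x' v' xx' vv' _; exists n; apply: contra_not nc; exact: consistent_same.
Qed.

(** The strategy depends on the digits [v] through finite sequences, so the
union of all the answers at a given [x] is in the ideal. *)
Lemma lost_full_cube x0 v0 : lost 0 x0 v0 -> ideal_product I (range f).
Proof.
move=> [s [Is sloc] bs].
pose P n (x : Om) : set (X n) := [set u | forall l : seq nat, ~ s n x (nth 0%N l) u].
have Ploc n x y : same n x y -> P n x = P n y.
  move=> xy; apply/seteqP; split=> u Pu l; have := Pu l.
    by rewrite (sloc n x y _ (nth 0%N l)).
  by rewrite (sloc n x y _ (nth 0%N l)).
have IP n x : I n (~` P n x).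
  apply: (@ideal_sub _ _ (sI n) _ (\bigcup_(l : seq nat) s n x (nth 0%N l))).
    by move=> u /existsNP[l /contrapT h]; exists l.
  by apply: ideal_bigcup => //.
have posP n x : ~ I n (P n x).
  move=> h; apply: (@I_proper n); rewrite -(setUv (P n x)).
  exact: ideal_setU.
have neP n x : P n x !=set0 by exact: (positive_nonempty (sI n) (@posP n x)).
exists (local_cube P).
  split; first split.
  - by apply: (cube_fiberwise Ploc (fun n x _ => neP n x) x0) => n x _; exact: posP.
  - by move=> x; exact: (cube_closed Ploc (fun n x _ => neP n x)).
  - by apply: (cube_fiberwise Ploc (fun n x _ => neP n x) x0) => n x _; exact: IP.
rewrite -subset0 => x [Dx [y _ fy]].
have [w wy] := address_ex SY y.
have [k] : exists k, ~ consistent k x w.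
  apply: bs => // k _.
  have -> : s k x w = s k x (nth 0%N (mkseq w k)).
    by apply: sloc => // i ik; rewrite nth_mkseq.
  exact: Dx.
by apply; exists y; split=> //; rewrite fy.
Qed.

Lemma game_dichotomy x0 v0 : ideal_product I (range f) \/
  exists2 W, winning W & W 0%N x0 v0.
Proof.
have [/lost_full_cube|nl] := pselect (lost 0 x0 v0); first by left.
by right; exists (fun n x v => ~ lost n x v) => //; exact: not_lost_winning.
Qed.

End Game.

(** * Codes and their finite approximations *)

(** A recursive definition on trees in which a node may refer to all
shorter nodes of all objects. *)
Lemma layered_fix (D E : Type) (e0 : E)
    (row : (D -> seq nat -> E) -> D -> seq nat -> E) :
  (forall G G' d s, (forall d' s', (size s' < size s)%N -> G d' s' = G' d' s') ->
    row G d s = row G' d s) ->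
  exists G, forall d s, G d s = row G d s.
Proof.
move=> rowP; pose it k := iter k row (fun _ _ => e0).
have itS k d s : (size s < k)%N -> it k d s = it k.+1 d s.
  elim: k d s => // k IH d s sk; apply: rowP => d' s' s's.
  by apply: IH; exact: leq_trans s's sk.
have itW k l d s : (size s < k)%N -> (k <= l)%N -> it k d s = it l d s.
  move=> sk; elim: l => [|l IH]; first by rewrite leqn0 => /eqP ->.
  rewrite leq_eqVlt => /predU1P[->//|kl]; rewrite IH//.
  by apply: itS; exact: leq_trans sk kl.
exists (fun d s => it (size s).+1 d s) => d s /=; apply: rowP => d' s' s's.
by apply: esym; exact: (itW _ _ _ _ (ltnSn _) s's).
Qed.

(** The [j]-th entry of a node consists of: the index of its open set, the
digest of the next code (both read at [j = 0]), whether the basic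
set [j] meets the core, whether it meets the mesh, and the [j]-th value of the
certificate. *)
Definition entry : Type := (nat * nat * bool * bool * nat)%type.
(** The first component is the last digit [v] of the position, which the
digest of order 1 reveals.  The nodes of the tree are written backwards: the
children of [s] are the sequences [j :: s]. *)
Definition code : Type := (nat * (seq nat -> nat -> entry))%type.

Definition nd_open (q : code) s : nat := (q.2 s 0%N).1.1.1.1.
Definition nd_digest (q : code) s : nat := (q.2 s 0%N).1.1.1.2.
Definition nd_core (q : code) s j : bool := (q.2 s j).1.1.2.
Definition nd_mesh (q : code) s j : bool := (q.2 s j).1.2.
Definition nd_wit (q : code) s j : nat := (q.2 s j).2.

Definition info_nodes m : seq (seq nat) :=
  [seq s <- pmap pickle_inv (iota 0 m) | (size s < m)%N].

(** The approximation of order [m] of a code.  It involves only nodes of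
length less than [m], which is what makes the recursion on the length of nodes
possible, and every entry appears in the approximations of large order. *)
Definition info m (q : code) : seq nat * seq (seq (nat * nat * bool * bool * nat)) :=
  (take m [:: q.1], [seq [seq q.2 s j | j <- iota 0 m] | s <- info_nodes m]).

Definition digest m q : nat := pickle (info m q).

Lemma digest_info m q q' : digest m q = digest m q' <-> info m q = info m q'.
Proof.
split=> [e|e]; last by rewrite /digest e.
exact: (pcan_inj pickleK) e.
Qed.

Lemma mem_info_nodes m s :
  s \in info_nodes m <-> (pickle s < m)%N /\ (size s < m)%N.
Proof.
rewrite mem_filter mem_pmap; split=> [/andP[-> /mapP[i]]|[pm ->]].
  rewrite mem_iota => /andP[_ im] si; split=> //.
  by have := @pickle_invK (seq nat) i; rewrite -si /= => ->.
by apply/mapP; exists (pickle s); rewrite ?mem_iota// pickleK_inv.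
Qed.

(** The least order of approximation that reveals the entry [j] of [s]. *)
Definition cov (s : seq nat) j := (maxn (pickle s) (maxn (size s) j)).+1.

Lemma cov_le s j m : (cov s j <= m)%N = [&& (pickle s < m)%N, (size s < m)%N & (j < m)%N].
Proof. by rewrite /cov !gtn_max. Qed.

Lemma infoP m q q' : info m q = info m q' <->
  ((0 < m)%N -> q.1 = q'.1) /\ forall s j, (cov s j <= m)%N -> q.2 s j = q'.2 s j.
Proof.
split=> [[e1 e2]|[e1 e2]].
  split=> [|s j]; first by case: m e1 {e2} => // m [].
  rewrite cov_le => /and3P[pm sm jm].
  have sn : s \in info_nodes m by apply/mem_info_nodes.
  have /(_ s sn) := (eq_in_map _ _ _).2 e2.
  by move/(eq_in_map _ _ _).2/(_ j); apply; rewrite mem_iota.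
rewrite /info; congr pair; first by case: m e1 {e2} => //= m ->.
apply/eq_in_map => s /mem_info_nodes[pm sm]; apply/eq_in_map => j.
by rewrite mem_iota => /andP[_ jm]; apply: e2; rewrite cov_le pm sm.
Qed.

Lemma infoW m n q q' : (m <= n)%N -> info n q = info n q' -> info m q = info m q'.
Proof.
move=> mn /infoP[e1 e2]; apply/infoP; split=> [m0|s j sm].
  by apply: e1; exact: leq_trans mn.
by apply: e2; exact: leq_trans sm mn.
Qed.

Lemma info_entry m q q' s j : info m q = info m q' -> (cov s j <= m)%N ->
  q.2 s j = q'.2 s j.
Proof. by move=> /infoP[_ +]; apply. Qed.

Lemma info_lim (q : nat -> code) : (forall m, info m (q m) = info m (q m.+1)) ->
  exists q', forall m, info m q' = info m (q m).
Proof.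
move=> qc.
have qW m n : (m <= n)%N -> info m (q m) = info m (q n).
  elim: n => [|n IH]; first by rewrite leqn0 => /eqP ->.
  rewrite leq_eqVlt => /predU1P[->//|mn]; rewrite IH//.
  exact: infoW (ltnSE mn) (qc n).
exists ((q 1%N).1, fun s j => (q (cov s j)).2 s j) => m; apply/infoP; split=> [m0|s j sm] /=.
  by have /infoP[+ _] := qW _ _ m0; apply.
exact: info_entry (qW _ _ sm) (leqnn _).
Qed.

(** * The codes of winning positions and their cube *)

Section Codes.
Variables (X : nat -> topologicalType) (I : forall n, set (set (X n))).
Local Notation Om := (omega_prod X).
Arguments I : clear implicits.
Hypothesis sI : forall n, sigma_ideal (I n).
Variables (B : forall n, nat -> set (X n)) (sm : nat -> nat -> nat -> Prop).
Arguments B : clear implicits.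
Hypothesis S : forall n, scheme (B n) (sm n).
Variable T : nat -> nat -> (nat -> bool) -> (nat -> nat) -> Prop.
Hypothesis T_local : forall n, tree_local (T n).
Hypothesis T_spec : forall n k,
  ~ I n (trace_set (B n) k) <-> exists w, forall m, T n m k w.
Variable W : nat -> Om -> (nat -> nat) -> Prop.
Hypothesis W_positive : forall n x v, W n x v -> ~ I n (@successors X W n x v).

Definition state : Type := (Om * (nat -> nat))%type.
Definition assignment : Type := nat * state -> seq nat -> nat -> entry.

Definition step n (p : state) (u : X n) (p' : state) :=
  [/\ same n p'.1 p.1, agree n p'.2 p.2, p'.1 n = u & W n.+1 p'.1 p'.2].

Definition code_of (G : assignment) n (p : state) : code := (p.2 n.-1, G (n, p)).

(** What a node of length [k] with open set [o] and digest [t] stands for at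
the position [p]: the points of [o] that lead to a position of [W] whose code
has the digest [t].  The invariant of the construction is that this set is
positive. *)
Definition node_set (G : assignment) n p k o t : set (X n) :=
  [set u | B n o u /\ exists p', step p u p' /\ digest k (code_of G n.+1 p') = t].

Definition node_pieces (G : assignment) n p k o t t' : set (X n) :=
  [set u | B n o u /\ exists p', [/\ step p u p',
    digest k (code_of G n.+1 p') = t & digest k.+1 (code_of G n.+1 p') = t']].

Arguments node_set : clear implicits.
Arguments node_pieces : clear implicits.

Definition is_children n (A : nat -> set (X n)) o k (c : nat -> nat * nat) :=
    [/\ forall j, [/\ closure (B n (c j).1) `<=` B n o, sm n k (c j).1,
          ~ I n (A (c j).2 `&` B n (c j).1) &
          mesh (I n) (B n) (A (c j).2 `&` B n (c j).1) `<=`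
          mesh (I n) (B n) (\bigcup_t A t)],
        forall i j, B n (c i).1 `&` B n (c j).1 `&`
          mesh (I n) (B n) (\bigcup_t A t) !=set0 -> c i = c j &
        forall j, B n j `&` core (I n) (B n) (\bigcup_t A t) !=set0 ->
          B n j `&` core (I n) (B n) (A (c j).2 `&` B n (c j).1) !=set0].

(** A function of the family of pieces and not of the node, so that two
nodes with the same open set and digest have the same subtrees. *)
Definition the_children n (A : nat -> set (X n)) o k : nat -> nat * nat :=
  xget (fun=> (0%N, 0%N)) [set c | is_children A o k c].

Lemma the_childrenP n (A : nat -> set (X n)) o k : (forall t, A t `<=` B n o) ->
  ~ I n (\bigcup_t A t) -> is_children A o k (the_children A o k).
Proof.
move=> AO Apos; apply: (@xgetPex _ _ [set c | is_children A o k c]).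
exact: (@children _ _ (sI n) _ _ (S n) A o k AO Apos).
Qed.

Definition digest0 : nat := digest 0 (0%N, fun _ _ => (0, 0, false, false, 0)%N).

Lemma digest0E q : digest 0 q = digest0. Proof. by apply/digest_info/infoP; split. Qed.

Definition open_digest (G : assignment) n p (s : seq nat) : nat * nat :=
  if s is j :: s' then
    let q := code_of G n p in
    the_children (node_pieces G n p (size s') (nd_open q s') (nd_digest q s'))
      (nd_open q s') (size s').+1 j
  else (0%N, digest0).

(** The node [s] computed from shorter nodes: from its parent at the same
position, and from the approximations of order [size s] of the next codes. *)
Definition row (G : assignment) (np : nat * state) (s : seq nat) : nat -> entry :=
  let: (n, p) := np in
  let ot := open_digest G n p s in
  let A := node_set G n p (size s) ot.1 ot.2 in
  let kap j := `[< B n j `&` core (I n) (B n) A !=set0 >] in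
  fun j => (ot.1, ot.2, kap j, `[< B n j `&` mesh (I n) (B n) A !=set0 >],
    xget (fun=> 0%N) [set w | forall m, T n m kap w] j).

Lemma row_layered (G G' : assignment) d s :
  (forall d' s', (size s' < size s)%N -> G d' s' = G' d' s') ->
  row G d s = row G' d s.
Proof.
case: d => n p GG'.
have tagE k n' p' : (k <= size s)%N -> digest k (code_of G n' p') = digest k (code_of G' n' p').
  move=> ks; apply/digest_info/infoP; split=> //= s' j.
  rewrite cov_le => /and3P[_ s'k _]; rewrite GG'//.
  exact: leq_trans s'k ks.
have otE : open_digest G n p s = open_digest G' n p s.
  case: s GG' tagE => [|j s] GG' tagE; first by [].
  have e0 : (code_of G n p).2 s 0%N = (code_of G' n p).2 s 0%N.
    by rewrite /code_of /= GG'.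
  rewrite /open_digest /nd_open /nd_digest e0; congr (the_children _ _ _ _).
  apply/funext => t; apply/seteqP; split=> u [Bu [p' [st t1 t2]]].
    by split; [exact: Bu|exists p'; rewrite -!tagE].
  by split; [exact: Bu|exists p'; rewrite !tagE].
rewrite /row otE.
have -> // : node_set G n p (size s) (open_digest G' n p s).1 (open_digest G' n p s).2 =
  node_set G' n p (size s) (open_digest G' n p s).1 (open_digest G' n p s).2.
apply/seteqP; split=> u [Bu [p' [st t1]]].
  by split; [exact: Bu|exists p'; rewrite -tagE].
by split; [exact: Bu|exists p'; rewrite tagE].
Qed.

Lemma assignment_ex : exists G : assignment, forall d s, G d s = row G d s.
Proof. by apply: layered_fix row_layered; exact: (fun=> (0, 0, false, false, 0)%N). Qed.

Variable G : assignment.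
Hypothesis G_fix : forall d s, G d s = row G d s.
Local Notation Q := (code_of G).

Definition piece n p s : set (X n) :=
  node_set G n p (size s) (nd_open (Q n p) s) (nd_digest (Q n p) s).

Arguments piece : clear implicits.

Lemma rowE n p s j : (Q n p).2 s j = row G (n, p) s j.
Proof. by rewrite /= G_fix. Qed.

Lemma open_digestE n p s : (nd_open (Q n p) s, nd_digest (Q n p) s) = open_digest G n p s.
Proof. by rewrite /nd_open /nd_digest !rowE /row /=; case: open_digest. Qed.

Lemma nd_coreE n p s j :
  nd_core (Q n p) s j = `[< B n j `&` core (I n) (B n) (piece n p s) !=set0 >].
Proof. by rewrite /nd_core rowE /row /= /piece -open_digestE. Qed.

Lemma nd_meshE n p s j :
  nd_mesh (Q n p) s j = `[< B n j `&` mesh (I n) (B n) (piece n p s) !=set0 >].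
Proof. by rewrite /nd_mesh rowE /row /= /piece -open_digestE. Qed.

Lemma nd_witE n p s : ~ I n (piece n p s) ->
  forall m, T n m (nd_core (Q n p) s) (nd_wit (Q n p) s).
Proof.
move=> pos.
have [w wP] : exists w, forall m, T n m (nd_core (Q n p) s) w.
  apply/T_spec; apply: contra_not (core_pos (sI n) (B := B n) pos).
  apply: (ideal_sub (sI n)) => x cx j Bx; rewrite nd_coreE.
  by apply/asboolP; exists x.
have -> : nd_wit (Q n p) s = xget (fun=> 0%N) [set w | forall m, T n m (nd_core (Q n p) s) w].
  apply/funext => j; rewrite /nd_wit rowE /row /=; congr (xget _ _ _).
  apply/funext => w'; apply/propext; rewrite /=.
  have -> // : nd_core (Q n p) s = fun j => `[< B n j `&` core (I n) (B n)
    (node_set G n p (size s) (open_digest G n p s).1 (open_digest G n p s).2) !=set0 >].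
  by apply/funext => i; rewrite nd_coreE /piece -open_digestE.
by apply: (@xgetPex _ _ [set w | forall m, T n m (nd_core (Q n p) s) w]); exists w.
Qed.

Lemma pieces_union n p s : \bigcup_t node_pieces G n p (size s)
    (nd_open (Q n p) s) (nd_digest (Q n p) s) t = piece n p s.
Proof.
apply/seteqP; split=> [u [t _ [Bu [p' [st t1 t2]]]]|u [Bu [p' [st t1]]]].
  by split=> //; exists p'.
by exists (digest (size s).+1 (Q n.+1 p')) => //; split=> //; exists p'.
Qed.

(** The digest of order [size s] of the parent is implied by that of the
child, because some code has both. *)
Lemma piece_child n p s j : ~ I n (piece n p s) ->
  node_pieces G n p (size s) (nd_open (Q n p) s) (nd_digest (Q n p) s)
    (nd_digest (Q n p) (j :: s)) `&` B n (nd_open (Q n p) (j :: s)) =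
  piece n p (j :: s).
Proof.
move=> pos.
have [] := @the_childrenP n (node_pieces G n p (size s) (nd_open (Q n p) s)
  (nd_digest (Q n p) s)) (nd_open (Q n p) s) (size s).+1.
- by move=> t u [].
- by rewrite pieces_union.
have /= otE := open_digestE n p (j :: s).
move=> /(_ j); rewrite -otE /= => -[clo _ /(positive_nonempty (sI n))[u0 [[_ [p0 [_ t0 t0']]] _]] _] _ _.
apply/seteqP; split=> [u [[Bu [p' [st t1 t2]]] Bju]|u [Bju [p' [st t1]]]].
  by split=> //; exists p'.
split=> //; split; first by apply: clo; exact: subset_closure.
exists p'; split=> //; rewrite -t0; apply/digest_info.
by apply: (infoW (leqnSn _)); apply/digest_info; rewrite t0'.
Qed.

Lemma piece_pos n p s : W n p.1 p.2 -> ~ I n (piece n p s).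
Proof.
move=> Wp; elim: s => [|j s IH].
  have := open_digestE n p [::]; rewrite /= => -[op0 t0].
  rewrite /piece op0 t0; apply: contra_not (W_positive Wp).
  apply: (ideal_sub (sI n)) => u [x' [v' [xx vv xu Wx]]].
  split; first by rewrite (scheme_top (S n)).
  by exists (x', v'); split; [split|exact: digest0E].
rewrite -piece_child//.
have [||/(_ j) + _ _] := @the_childrenP n (node_pieces G n p (size s) (nd_open (Q n p) s)
  (nd_digest (Q n p) s)) (nd_open (Q n p) s) (size s).+1.
- by move=> t u [].
- by rewrite pieces_union.
by have /= otE := open_digestE n p (j :: s); rewrite -otE /= => -[].
Qed.

Lemma children_codes n p s : W n p.1 p.2 ->
  [/\ forall j, [/\ closure (B n (nd_open (Q n p) (j :: s))) `<=` B n (nd_open (Q n p) s),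
          sm n (size s).+1 (nd_open (Q n p) (j :: s)) &
          mesh (I n) (B n) (piece n p (j :: s)) `<=` mesh (I n) (B n) (piece n p s)],
        forall i j, B n (nd_open (Q n p) (i :: s)) `&` B n (nd_open (Q n p) (j :: s)) `&`
          mesh (I n) (B n) (piece n p s) !=set0 ->
          (nd_open (Q n p) (i :: s), nd_digest (Q n p) (i :: s)) =
          (nd_open (Q n p) (j :: s), nd_digest (Q n p) (j :: s)) &
        forall j, B n j `&` core (I n) (B n) (piece n p s) !=set0 ->
          B n j `&` core (I n) (B n) (piece n p (j :: s)) !=set0].
Proof.
move=> Wp; have pos := piece_pos (s := s) Wp.
have [||h1 h2 h3] := @the_childrenP n (node_pieces G n p (size s) (nd_open (Q n p) s)
  (nd_digest (Q n p) s)) (nd_open (Q n p) s) (size s).+1.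
- by move=> t u [].
- by rewrite pieces_union.
have otE j : the_children _ _ _ j = _ := esym (open_digestE n p (j :: s)).
split=> [j|i j|j].
- by have := h1 j; rewrite otE /= pieces_union piece_child// => -[].
- by have := h2 i j; rewrite !otE /= pieces_union.
- by have := h3 j; rewrite otE /= pieces_union piece_child.
Qed.

(** The requirements on codes.  Each of them, for given nodes and indices,
involves finitely many entries of the code only, so they pass to limits.  In
particular disjointness inside the mesh is stated with basic sets that the mesh
code allows: its semantical form is not preserved under limits. *)
Record good n (q : code) : Prop := Good {
  g_root : nd_open q [::] = 0%N;
  g_nonempty : forall s, B n (nd_open q s) !=set0;
  g_nested : forall s j,
    closure (B n (nd_open q (j :: s))) `<=` B n (nd_open q s);
  g_small : forall s, sm n (size s) (nd_open q s);
  g_disjoint : forall s i j l, B n l `<=` B n (nd_open q (i :: s)) ->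
    B n l `<=` B n (nd_open q (j :: s)) -> nd_mesh q s l ->
    (nd_open q (i :: s), nd_digest q (i :: s)) = (nd_open q (j :: s), nd_digest q (j :: s));
  g_core : forall s j, nd_core q s j -> nd_core q (j :: s) j;
  g_core_meets : forall s j, nd_core q s j -> B n j `&` B n (nd_open q s) !=set0;
  g_wit : forall s m, T n m (nd_core q s) (nd_wit q s);
  g_same : forall s s', size s = size s' ->
    (nd_open q s, nd_digest q s) = (nd_open q s', nd_digest q s') ->
    forall j, (nd_open q (j :: s), nd_digest q (j :: s)) =
              (nd_open q (j :: s'), nd_digest q (j :: s')) /\
              nd_mesh q s j = nd_mesh q s' j;
  g_meshS : forall s j l, nd_mesh q (j :: s) l -> nd_mesh q s l;
  g_mesh_open : forall s l, B n (nd_open q s) `<=` B n l -> nd_mesh q s l;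
  g_next : forall s j, exists p', [/\ W n.+1 p'.1 p'.2,
    digest (size s) (Q n.+1 p') = nd_digest q s &
    digest (size s).+1 (Q n.+1 p') = nd_digest q (j :: s)] }.

Lemma piece_open n p s : piece n p s `<=` B n (nd_open (Q n p) s).
Proof. by move=> u []. Qed.

Lemma code_good n p : W n p.1 p.2 -> good n (Q n p).
Proof.
move=> Wp.
have pos s : ~ I n (piece n p s) by exact: piece_pos.
have ne s : piece n p s !=set0 by exact: (positive_nonempty (sI n) (pos s)).
have sameP s s' : size s = size s' ->
    (nd_open (Q n p) s, nd_digest (Q n p) s) = (nd_open (Q n p) s', nd_digest (Q n p) s') ->
    piece n p s = piece n p s'.
  by move=> ss [eo et]; rewrite /piece ss eo et.
split.
- by have := open_digestE n p [::]; rewrite /= => -[].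
- by move=> s; have [u /piece_open] := ne s; exists u.
- by move=> s j; have [/(_ j)[]] := children_codes s Wp.
- case=> [|j s]; first exact: small0 (S n) _.
  by have [/(_ j)[]] := children_codes s Wp.
- move=> s i j l li lj; rewrite nd_meshE => /asboolP[x [lx mx]].
  have [_ + _] := children_codes s Wp; apply; exists x; split=> //.
  by split; [exact: li|exact: lj].
- move=> s j; rewrite !nd_coreE => /asboolP h; apply/asboolP.
  by have [_ _] := children_codes s Wp; apply.
- move=> s j; rewrite nd_coreE => /asboolP[x [jx /core_hull/hull_closure cx]].
  have [|y [/piece_open py jy]] := cx (B n j); last by exists y.
  by apply: open_nbhs_nbhs; split=> //; exact: scheme_open (S n) _.
- by move=> s m; exact: nd_witE.
- move=> s s' ss ee j; split; last by rewrite !nd_meshE (sameP _ _ ss ee).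
  by rewrite !open_digestE /= ss; case: ee => -> ->.
- move=> s j l; rewrite !nd_meshE => /asboolP[x [lx mx]]; apply/asboolP.
  by exists x; split=> //; have [/(_ j)[_ _ +] _ _] := children_codes s Wp; exact.
- move=> s l sl; rewrite nd_meshE; apply/asboolP.
  have : ~ I n (reduct (I n) (B n) (piece n p s) `&` setT).
    by apply: (meets_reduct (sI n)); rewrite setIT.
  move=> /(positive_nonempty (sI n))[x [rx _]]; exists x; split.
    by apply/sl/piece_open; exact: reduct_sub rx.
  by apply/hull_mesh/subset_closure.
- move=> s j; have [u] := ne (j :: s); rewrite -piece_child//.
  by move=> [[_ [p' [[_ _ _ Wp'] t1 t2]]] _]; exists p'.
Qed.

(** The codes that are approximated to any order by codes of positions of
[W]; those met along the cube are of this kind. *)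
Definition limit_code n (q : code) : Prop :=
  forall m, exists p, W n p.1 p.2 /\ info m (Q n p) = info m q.

Lemma limit_entries n q (L : seq (seq nat * nat)) : limit_code n q ->
  exists p, W n p.1 p.2 /\
    forall s j, (s, j) \in L -> (Q n p).2 s j = q.2 s j.
Proof.
move=> /(_ (\max_(z <- L) cov z.1 z.2)%N)[p [Wp e]]; exists p; split=> // s j sj.
by apply: info_entry e _; exact: (@leq_bigmax_seq _ L xpredT (fun z => cov z.1 z.2) (s, j) sj isT).
Qed.

Lemma code_limit n p : W n p.1 p.2 -> limit_code n (Q n p).
Proof. by move=> Wp m; exists p. Qed.

Lemma limit_good n q : limit_code n q -> good n q.
Proof.
move=> Lq.
have oE p s : (Q n p).2 s 0%N = q.2 s 0%N -> nd_open q s = nd_open (Q n p) s.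
  by rewrite /nd_open => ->.
have tE p s : (Q n p).2 s 0%N = q.2 s 0%N -> nd_digest q s = nd_digest (Q n p) s.
  by rewrite /nd_digest => ->.
have cE p s j : (Q n p).2 s j = q.2 s j -> nd_core q s j = nd_core (Q n p) s j.
  by rewrite /nd_core => ->.
have mE p s j : (Q n p).2 s j = q.2 s j -> nd_mesh q s j = nd_mesh (Q n p) s j.
  by rewrite /nd_mesh => ->.
split.
- have [p [Wp e]] := limit_entries [:: ([::], 0%N)] Lq.
  by rewrite (oE p) ?e ?inE//; exact: g_root (code_good Wp).
- move=> s; have [p [Wp e]] := limit_entries [:: (s, 0%N)] Lq.
  by rewrite (oE p) ?e ?inE ?eqxx//; exact: g_nonempty (code_good Wp) _.
- move=> s j; have [p [Wp e]] := limit_entries [:: (s, 0%N); (j :: s, 0%N)] Lq.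
  rewrite !(oE p) ?e ?inE ?eqxx ?orbT//; exact: g_nested (code_good Wp) _ _.
- move=> s; have [p [Wp e]] := limit_entries [:: (s, 0%N)] Lq.
  by rewrite (oE p) ?e ?inE ?eqxx//; exact: g_small (code_good Wp) _.
- move=> s i j l.
  have [p [Wp e]] := limit_entries [:: (i :: s, 0%N); (j :: s, 0%N); (s, l)] Lq.
  rewrite !(oE p) ?(tE p) ?(mE p) ?e ?inE ?eqxx ?orbT//.
  exact: g_disjoint (code_good Wp) _ _ _ _.
- move=> s j; have [p [Wp e]] := limit_entries [:: (s, j); (j :: s, j)] Lq.
  rewrite !(cE p) ?e ?inE ?eqxx ?orbT//; exact: g_core (code_good Wp) _ _.
- move=> s j; have [p [Wp e]] := limit_entries [:: (s, j); (s, 0%N)] Lq.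
  by rewrite (oE p) ?(cE p) ?e ?inE ?eqxx ?orbT//; exact: g_core_meets (code_good Wp) _ _.
- move=> s m; have [p [Wp e]] := Lq (cov s m).
  have es j : (j < m)%N -> (Q n p).2 s j = q.2 s j.
    move=> jm; apply: info_entry e _; rewrite cov_le.
    have : (cov s m <= cov s m)%N by [].
    by rewrite {1}cov_le => /and3P[-> -> mm]; exact: ltn_trans mm.
  apply: T_local (g_wit (code_good Wp) s m) => j jm.
    by rewrite (cE p)// es.
  by rewrite /nd_wit es.
- move=> s s' ss + j.
  have [p [Wp e]] := limit_entries [:: (s, 0%N); (s', 0%N); (j :: s, 0%N);
    (j :: s', 0%N); (s, j); (s', j)] Lq.
  rewrite !(oE p) ?(tE p) ?(mE p) ?e ?inE ?eqxx ?orbT// => ee.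
  exact: (g_same (code_good Wp)).
- move=> s j l; have [p [Wp e]] := limit_entries [:: (s, l); (j :: s, l)] Lq.
  rewrite !(mE p) ?e ?inE ?eqxx ?orbT//; exact: g_meshS (code_good Wp) _ _ _.
- move=> s l; have [p [Wp e]] := limit_entries [:: (s, 0%N); (s, l)] Lq.
  rewrite !(oE p) ?(mE p) ?e ?inE ?eqxx ?orbT//; exact: g_mesh_open (code_good Wp) _ _.
- move=> s j; have [p [Wp e]] := limit_entries [:: (s, 0%N); (j :: s, 0%N)] Lq.
  rewrite !(tE p) ?e ?inE ?eqxx ?orbT//; exact: g_next (code_good Wp) _ _.
Qed.

(** The second condition places [u] in the mesh of each node that contains
it; with it, [u] is in at most one node of each length, up to repetition. *)
Definition section_set n (q : code) : set (X n) := [set u |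
  (forall m, exists s, size s = m /\ B n (nd_open q s) u) /\
  forall s l, B n (nd_open q s) u -> B n l u -> nd_mesh q s l].

Arguments section_set : clear implicits.

Lemma nested_sub n q s j : good n q ->
  B n (nd_open q (j :: s)) `<=` B n (nd_open q s).
Proof. by move=> gq x /(@subset_closure _ _ _)/(g_nested gq). Qed.

Lemma open_cat n q s1 s2 : good n q ->
  B n (nd_open q (s1 ++ s2)) `<=` B n (nd_open q s2).
Proof.
move=> gq; elim: s1 => // j s1 IH; apply: subset_trans IH.
exact: nested_sub.
Qed.

Lemma mesh_cat n q s1 s2 l : good n q -> nd_mesh q (s1 ++ s2) l -> nd_mesh q s2 l.
Proof. by move=> gq; elim: s1 => // j s1 IH /(g_meshS gq). Qed.

(** Two nodes of the same length with a common point [u] descend, by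
induction, from equal parents, and [u] is in the mesh of the parent, where
distinct children are disjoint. *)
Lemma node_unique n q s0 u : good n q -> B n (nd_open q s0) u ->
  (forall s1 s2, s0 = s1 ++ s2 -> forall l, B n l u -> nd_mesh q s2 l) ->
  forall s, size s = size s0 -> B n (nd_open q s) u ->
  (nd_open q s, nd_digest q s) = (nd_open q s0, nd_digest q s0).
Proof.
move=> gq; elim: s0 => [_ _ []//|i s0 IH] u0 msh [//|j s] /= [ss] us.
have ee : (nd_open q s, nd_digest q s) = (nd_open q s0, nd_digest q s0).
  apply: IH => //; first exact: nested_sub u0.
    by move=> s1 s2 e; apply: (msh (i :: s1)); rewrite e.
  exact: nested_sub us.
have [ej _] := g_same gq ss ee j.
rewrite ej; have uj : B n (nd_open q (j :: s0)) u by case: ej => <- _.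
have oij : open (B n (nd_open q (j :: s0)) `&` B n (nd_open q (i :: s0))).
  by apply: openI; exact: scheme_open (S n) _.
have [l [lu lU _]] := scheme_refine (S n) 0 oij (conj uj u0).
apply: (g_disjoint gq (l := l)).
- by move=> x /(@subset_closure _ _ _)/lU[].
- by move=> x /(@subset_closure _ _ _)/lU[].
- exact: (msh [:: i]).
Qed.

Lemma section_unique n q u s s' : good n q -> section_set n q u -> size s = size s' ->
  B n (nd_open q s) u -> B n (nd_open q s') u ->
  (nd_open q s, nd_digest q s) = (nd_open q s', nd_digest q s').
Proof.
move=> gq [_ mu] ss us us'; apply: (@node_unique n q s' u) => // s1 s2 e l lu.
by apply: mu lu; apply: (@open_cat n q s1) => //; rewrite -e.
Qed.

Definition next_spec n (q : code) (u : X n) (q' : code) :=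
  limit_code n.+1 q' /\
  forall s, B n (nd_open q s) u -> digest (size s) q' = nd_digest q s.

(** The digests at the nodes that contain [u] are coherent, so they are the
approximations of one code. *)
Lemma next_ex n q u : good n q -> section_set n q u -> exists q', next_spec q u q'.
Proof.
move=> gq Su; have [ex _] := Su.
have [b bP] := choice ex.
have step m : exists p, W n.+1 p.1 p.2 /\ digest m (Q n.+1 p) = nd_digest q (b m).
  have [bm _] := bP m.
  by have [p [Wp t _]] := g_next gq (b m) 0; exists p; rewrite -{1}bm.
have [p pP] := choice step.
have coh m : info m (Q n.+1 (p m)) = info m (Q n.+1 (p m.+1)).
  have [bm um] := bP m; have [bm1 um1] := bP m.+1.
  case: (b m.+1) bm1 um1 (pP m.+1) => // j s [sm'] um1 [_ t1].
  have [p' [_ t2 t3]] := g_next gq s j.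
  have [_ t0] := pP m.
  have [_ ts] : (nd_open q s, nd_digest q s) = (nd_open q (b m), nd_digest q (b m)).
    by apply: (@section_unique n q u) => //; rewrite ?sm'//; exact: nested_sub um1.
  transitivity (info m (Q n.+1 p')); apply/digest_info.
    by rewrite t0 -ts -t2 sm'.
  by apply/digest_info/(infoW (leqnSn m))/digest_info; rewrite t1 -t3 sm'.
have [q' q'P] := info_lim coh.
exists q'; split=> [m|s us].
  by exists (p m); have [] := pP m.
have [bm um] := bP (size s).
have [_ ->] : (nd_open q s, nd_digest q s) = (nd_open q (b (size s)), nd_digest q (b (size s))).
  exact: (@section_unique n q u).
have [_ <-] := pP (size s).
by apply/digest_info.
Qed.

Hypothesis I_closed : forall n, generated_by_closed (I n).

(** The first basic sets of a branch that are contained in a given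
neighbourhood of its point [u] force that neighbourhood into the mesh of their
ancestors. *)
Lemma branch_section n q u (t : nat -> seq nat) : good n q ->
  (forall k, (k <= size (t k))%N) -> (forall k, exists s, t k.+1 = s ++ t k) ->
  (forall k, B n (nd_open q (t k)) u) -> section_set n q u.
Proof.
move=> gq tk tS tu.
have tmono k l : (k <= l)%N -> exists s, t l = s ++ t k.
  elim: l => [|l IH]; first by rewrite leqn0 => /eqP ->; exists [::].
  rewrite leq_eqVlt => /predU1P[->|kl]; first by exists [::].
  have [s1 e1] := IH kl; have [s2 e2] := tS l.
  by exists (s2 ++ s1); rewrite e2 e1 catA.
have meshP k s1 s2 l : t k = s1 ++ s2 -> B n l u -> nd_mesh q s2 l.
  move=> e lu; have [m mP] := scheme_shrink (S n) (scheme_open (S n) l) lu.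
  have [s0 e0] := tmono _ _ (leq_maxl k m).
  apply: (@mesh_cat n q (s0 ++ s1)) => //; rewrite -catA -e -e0.
  apply: (g_mesh_open gq); apply: mP => //.
  apply: smallW (S n) _ _ _ _ (g_small gq _).
  by apply: leq_trans (tk _); rewrite leq_maxr.
have node m : exists s0 s1, t m = s1 ++ s0 /\ size s0 = m.
  exists (drop (size (t m) - m) (t m)), (take (size (t m) - m) (t m)).
  by rewrite cat_take_drop size_drop subKn.
split=> [m|s l us lu].
  have [s0 [s1 [e sz]]] := node m; exists s0; split=> //.
  by apply: (@open_cat n q s1) => //; rewrite -e.
have [s0 [s1 [e sz]]] := node (size s).
have u0 : B n (nd_open q s0) u.
  by apply: (@open_cat n q s1) => //; rewrite -e.
have ee : (nd_open q s, nd_digest q s) = (nd_open q s0, nd_digest q s0).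
  apply: (@node_unique n q s0 u) => // s2 s3 e' l' l'u.
  by apply: (@meshP (size s) (s1 ++ s2) s3) => //; rewrite e e' catA.
have [_ ->] := g_same gq (esym sz) ee l.
exact: meshP e lu.
Qed.

(** The core of [s] is positive, so it is not contained in [F]: some basic
set [B n j] meets the core and has its closure disjoint from [F].  Following
the child of index [j] again and again, one stays close to [B n j] and ends up
off [F]. *)
Lemma avoid_closed n q s (F : set (X n)) : good n q -> closed F -> I n F ->
  exists s', (0 < size s')%N /\ B n (nd_open q (s' ++ s)) `&` F = set0.
Proof.
move=> gq cF IF.
have : ~ I n (trace_set (B n) (nd_core q s)).
  by apply/T_spec; exists (nd_wit q s); exact: g_wit.
move=> nK; have [x [Kx nFx]] : (trace_set (B n) (nd_core q s) `\` F) !=set0.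
  apply/set0P/eqP; rewrite setD_eq0 => /(ideal_sub (sI n))/(_ IF); exact: nK.
have [j [jx jF _]] := scheme_refine (S n) 0 (closed_openC cF) nFx.
have cj r : nd_core q (nseq r j ++ s) j.
  by elim: r => [|r IH]; [exact: Kx|exact: g_core gq _ _ IH].
have [y yJ] : exists y, forall r, B n (nd_open q (nseq r j ++ s)) y.
  apply: (scheme_complete (S n)) => m.
  - exact: g_nested gq _ _.
  - apply: smallW (S n) _ _ _ _ (g_small gq _).
    by rewrite size_cat size_nseq leq_addr.
  - exact: g_nonempty gq _.
have cly : closure (B n j) y.
  move=> U; rewrite nbhsE => -[V [oV Vy] VU].
  have [m mP] := scheme_shrink (S n) oV Vy.
  have [z [jz mz]] := g_core_meets gq (cj m).
  exists z; split=> //; apply: VU; apply: mP mz => //.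
  apply: smallW (S n) _ _ _ _ (g_small gq _).
  by rewrite size_cat size_nseq leq_addr.
have [m mP] := scheme_shrink (S n) (closed_openC cF) (jF _ cly).
exists (nseq m.+1 j); split; first by rewrite size_nseq.
rewrite -subset0 => z [mz Fz]; apply: (mP _ _ (yJ m.+1) z mz Fz).
apply: smallW (S n) _ _ _ _ (g_small gq _).
by rewrite size_cat size_nseq; apply: leq_trans (leqnSn m) (leq_addr _ _).
Qed.

(** Baire category: if countably many closed sets of the ideal covered the
section set, then avoiding them one after the other along a branch would lead
to a point of the section set in none of them. *)
Lemma section_positive n q : good n q -> ~ I n (section_set n q).
Proof.
move=> gq /I_closed[C [cC CP SC]].
have [F FP] : exists F : nat -> set (X n),
    (forall k, closed (F k) /\ I n (F k)) /\ section_set n q `<=` \bigcup_k F k.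
  have /countable_injP[e einj] := cC.
  pose F k := \bigcup_(A in [set A | C A /\ e A = k]) A.
  have FE A : C A -> F (e A) = A.
    move=> CA; apply/seteqP; split=> [x [A' [CA' ee] A'x]|x Ax]; last by exists A.
    by rewrite -(einj A' A) ?inE.
  exists F; split=> [k|x /SC[A CA Ax]]; last by exists (e A) => //; rewrite FE.
  have [[A [CA <-]]|nA] := pselect (exists A, C A /\ e A = k).
    by rewrite FE//; exact: CP.
  have -> : F k = set0.
    by rewrite -subset0 => x [A [CA ek] _]; apply: nA; exists A.
  by split; [exact: closed0|exact: ideal0].
have [Fcl FS] := FP.
have step (ks : nat * seq nat) : exists s', (0 < size s')%N /\
    B n (nd_open q (s' ++ ks.2)) `&` F ks.1 = set0.
  by have [cF IF] := Fcl ks.1; exact: avoid_closed.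
have [g gP] := choice step.
pose t := fix t k := if k is k'.+1 then g (k', t k') ++ t k' else [::].
have tk k : (k <= size (t k))%N.
  elim: k => //= k IH; rewrite size_cat -add1n leq_add//.
  by have [] := gP (k, t k).
have [u tu] : exists u, forall k, B n (nd_open q (t k)) u.
  apply: (scheme_complete (S n)) => k.
  - rewrite /=; have [] := gP (k, t k); case: (g (k, t k)) => // j s _ _.
    by move=> x /(g_nested gq); exact: open_cat.
  - exact: smallW (S n) _ _ _ (tk k) (g_small gq _).
  - exact: g_nonempty gq _.
have Su : section_set n q u.
  by apply: (branch_section gq tk _ tu) => k; exists (g (k, t k)).
have [k _ Fku] := FS _ Su.
have [_ /seteqP[+ _]] := gP (k, t k); move=> /(_ u) /=; apply; split=> //.
exact: (tu k.+1).
Qed.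

Variable p0 : state.
Hypothesis W_start : W 0 p0.1 p0.2.

Definition next_code n (q : code) (u : X n) : code := xget q [set q' | next_spec q u q'].

Fixpoint code_at n (x : Om) : code :=
  if n is m.+1 then next_code (code_at m x) (x m) else Q 0 p0.

Definition cube_section n (x : Om) : set (X n) := section_set n (code_at n x).
Arguments cube_section : clear implicits.
Local Notation E n := [set x | follows cube_section n x].

Lemma code_at_same n x y : same n x y -> code_at n x = code_at n y.
Proof.
elim: n => //= n IH xy; rewrite IH ?xy//.
exact: sameW xy.
Qed.

Lemma cube_section_local n x y : same n x y -> cube_section n x = cube_section n y.
Proof. by move=> /code_at_same e; rewrite /cube_section e. Qed.

Lemma next_codeP n x : limit_code n (code_at n x) -> cube_section n x (x n) ->
  next_spec (code_at n x) (x n) (code_at n.+1 x).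
Proof.
move=> /limit_good gx sx.
exact: (@xgetPex _ _ [set q' | next_spec (code_at n x) (x n) q'] (next_ex gx sx)).
Qed.

Lemma follows_limit n x : E n x -> limit_code n (code_at n x).
Proof.
elim: n => [_|n IH /followsS[/IH Lx sx]]; first exact: code_limit.
by have [] := next_codeP Lx sx.
Qed.

Lemma cube_section_positive n x : E n x -> ~ I n (cube_section n x).
Proof. by move=> /follows_limit/limit_good; exact: section_positive. Qed.

Lemma cube_section_nonempty n x : E n x -> cube_section n x !=set0.
Proof. by move=> /cube_section_positive; exact: positive_nonempty. Qed.

(** An approximation of the next code is a digest, found at a node whose
open set contains the last coordinate, so it persists near [x]. *)
Lemma code_at_locally_const n m x : E n x -> exists V, [/\ open V, V x &
  forall x', V x' -> E n x' -> info m (code_at n x') = info m (code_at n x)].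
Proof.
elim: n m => [|n IH] m; first by exists setT; split=> //; exact: openT.
move=> /followsS[Ex sx]; have Lx := follows_limit Ex.
have [Lx' /[dup] nx] := next_codeP Lx sx.
have [/(_ m)[s [sz us]] _] := sx => /(_ s us) ts.
have [V [oV Vx VP]] := IH (cov s 0) Ex.
exists (V `&` [set y | B n (nd_open (code_at n x) s) (y n)]); split=> //.
  by apply: openI => //; apply: open_coord; exact: scheme_open (S n) _.
move=> x' [Vx' ux'] /followsS[Ex' sx'].
have es : (code_at n x').2 s 0%N = (code_at n x).2 s 0%N.
  exact: info_entry (VP x' Vx' Ex') (leqnn _).
have [_ /(_ s)] := next_codeP (follows_limit Ex') sx'.
rewrite /nd_open /nd_digest es => /(_ ux') ts'.
by apply/digest_info; rewrite -sz ts' ts.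
Qed.

Lemma code_condition_open n m (Z : set code) :
  (forall q q', info m q = info m q' -> Z q -> Z q') ->
  exists2 O : set Om, open O & forall x, E n x -> (O x <-> Z (code_at n x)).
Proof.
move=> Zm.
exists (\bigcup_(V in [set V : set Om | open V /\
    forall x, V x -> E n x -> Z (code_at n x)]) V).
  by apply: bigcup_open => V [].
move=> x Ex; split=> [[V [_ VZ] Vx]|Zx]; first exact: VZ.
have [V [oV Vx VP]] := code_at_locally_const m Ex.
exists V => //; split=> // y Vy Ey; apply: Zm Zx.
by rewrite VP.
Qed.

(** Relative to the previous rounds, the first condition on the new
coordinate is a countable intersection of open conditions, and the second one
of closed conditions on a single coordinate. *)
Lemma follows_Gdelta n : Gdelta (E n).
Proof.
elim: n => [|n IH].
  have -> : E 0 = setT by rewrite -subTset => x _ k.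
  by apply: open_Gdelta; exact: openT.
have op_ex (so : seq nat * nat) : exists O : set Om, open O /\
    forall x, E n x -> (O x <-> nd_open (code_at n x) so.1 = so.2).
  have [|O oO OE] := @code_condition_open n (cov so.1 0)
    [set q | nd_open q so.1 = so.2]; last by exists O.
  by move=> q q' qq /=; rewrite /nd_open (info_entry qq).
have [Ob OP] := choice op_ex.
(* The index [o] of the open set of the node is guessed, so that the closed
   condition involves fixed basic sets; wrong guesses form an open set. *)
have ms_ex (slo : seq nat * nat * nat) : exists N : set Om, open N /\
    forall x, E n x -> (N x <-> (nd_open (code_at n x) slo.1.1 <> slo.2 \/
      nd_mesh (code_at n x) slo.1.1 slo.1.2)).
  have [|N oN NE] := @code_condition_open n (cov slo.1.1 slo.1.2)
    [set q | nd_open q slo.1.1 <> slo.2 \/ nd_mesh q slo.1.1 slo.1.2];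
    last by exists N.
  move=> q q' qq; rewrite /= /nd_open /nd_mesh.
  have <- : q.2 slo.1.1 slo.1.2 = q'.2 slo.1.1 slo.1.2 by exact: info_entry qq _.
  have <- // : q.2 slo.1.1 0 = q'.2 slo.1.1 0.
  apply: info_entry qq _.
  have : (cov slo.1.1 slo.1.2 <= cov slo.1.1 slo.1.2)%N by [].
  rewrite {1}cov_le => /and3P[h1 h2 h3]; rewrite cov_le h1 h2 /=.
  exact: leq_ltn_trans h3.
have [N NP] := choice ms_ex.
have -> : E n.+1 = E n `&` ((\bigcap_m \bigcup_(so in [set so | size so.1 = m])
      (Ob so `&` [set x : Om | B n so.2 (x n)])) `&`
    (\bigcap_slo (N slo `|` (fun x : Om => x n) @^-1`
      (~` (B n slo.2 `&` B n slo.1.2))))).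
  apply/seteqP; split=> [x /followsS[Ex [sx1 sx2]]|x [Ex [Ax Cx]]].
    split=> //; split=> [m _|[[s l] o] _].
      have [s [sz us]] := sx1 m.
      exists (s, nd_open (code_at n x) s) => //; split=> //.
      by have [_ OE] := OP (s, nd_open (code_at n x) s); apply/OE.
    have [[us lu]|] := pselect ((B n o `&` B n l) (x n)); last by right.
    left; have [_ NE] := NP (s, l, o); apply/NE => //=.
    have [e|] := pselect (nd_open (code_at n x) s = o); last by left.
    by right; apply: sx2 => //; rewrite e.
  apply/followsS; split=> //; split=> [m|s l us lu].
    have [[s o] /= sz [Oso us]] := Ax m Logic.I; exists s; split=> //.
    by have [_ OE] := OP (s, o); move/OE : Oso => ->.
  have [|[]//] := Cx (s, l, nd_open (code_at n x) s) Logic.I.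
  have [_ NE] := NP (s, l, nd_open (code_at n x) s).
  by move=> /NE[].
apply: Gdelta_setI => //; apply: Gdelta_setI; apply: Gdelta_bigcap.
  move=> m; apply: open_Gdelta; apply: bigcup_open => so _.
  apply: openI; first by have [] := OP so.
  by apply: open_coord; exact: scheme_open (S n) _.
move=> slo; apply: Gdelta_open_setU; first by have [] := NP slo.
apply: Gdelta_preimage; first exact: proj_cont.
apply: (Gdelta_closed (S n)); apply: open_closedC.
by apply: openI; exact: scheme_open (S n) _.
Qed.

Lemma cube_positive_Gdelta : positive_Gdelta_cube I (local_cube cube_section).
Proof.
split; first split.
- apply: (cube_fiberwise cube_section_local cube_section_nonempty p0.1).
  exact: cube_section_positive.
- exact: (cube_closed cube_section_local cube_section_nonempty).
- move=> n; apply: (projection_Gdelta cube_section_local cube_section_nonempty p0.1).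
  exact: follows_Gdelta.
- have -> : local_cube cube_section = \bigcap_n E n.
    apply/seteqP; split=> [x Dx n _ k _|x h n]; first exact: Dx.
    by have /followsS[] := h n.+1 Logic.I.
  by apply: Gdelta_bigcap => n; exact: follows_Gdelta.
Qed.

(** A node of the code at [x] that contains [x n] is also a node of the code
of an approximating position, where its set is positive, hence nonempty: this
gives the next position. *)
Lemma cube_approx n m x : local_cube cube_section x -> (0 < m)%N ->
  exists p, [/\ W n p.1 p.2, info m (Q n p) = info m (code_at n x),
    forall k, (k < n)%N -> p.2 k = (code_at k.+1 x).1 &
    forall k, (k < n)%N -> exists j, [/\ sm k m j, B k j (x k) & B k j (p.1 k)]].
Proof.
move=> Dx; have Ex k : E k x by move=> i _; exact: Dx.
elim: n m => [|n IH] m m0; first by exists p0.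
have Lx := follows_limit (Ex n); have sx := Dx n.
have [_ nx] := next_codeP Lx sx.
have [/(_ m)[s [sz us]] _] := sx.
have [p [Wp e lp ap]] := IH (maxn m (cov s 0)) (leq_trans m0 (leq_maxl _ _)).
have es : (Q n p).2 s 0%N = (code_at n x).2 s 0%N.
  by apply: info_entry e _; rewrite leq_maxr.
have [u [Bu [p' [[xx vv xu Wp'] tp']]]] := positive_nonempty (sI n) (piece_pos (s := s) Wp).
have e' : info m (Q n.+1 p') = info m (code_at n.+1 x).
  by apply/digest_info; rewrite -sz tp' (nx s us) /nd_digest es.
exists p'; split=> // k; rewrite ltnS leq_eqVlt => /predU1P[->|kn].
- by have /infoP[/(_ m0) <- _] := e'.
- by rewrite vv// lp.
- exists (nd_open (code_at n x) s); split=> //.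
    by rewrite -{1}sz; exact: g_small (limit_good Lx) _.
  by rewrite xu /nd_open -es.
- have [j [sj jx jp]] := ap k kn; exists j; split=> //.
    exact: smallW (S k) _ _ _ (leq_maxl _ _) sj.
  by rewrite xx.
Qed.

End Codes.

(** * The theorem *)

(** The digits [v] are those of the approximating positions, so they form an
address of some [y]; by continuity [f y] is the limit of the approximating
positions, that is [x]. *)
Lemma consistent_limit (X : nat -> topologicalType) (B : forall n, nat -> set (X n))
    (sm : nat -> nat -> nat -> Prop) (S : forall n, scheme (B n) (sm n))
    (Y : topologicalType) (BY : nat -> set Y) (smY : nat -> nat -> Prop)
    (SY : scheme BY smY) (f : Y -> omega_prod X) (x : omega_prod X) (v : nat -> nat) :
  (forall n, hausdorff_space (X n)) -> continuous f ->
  (forall m, exists x' v', [/\ consistent BY smY f m x' v', agree m v' v &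
     forall k, (k < m)%N -> exists j, [/\ sm k m j, B k j (x k) & B k j (x' k)]]) ->
  range f x.
Proof.
move=> hX cf app.
have [m|y vy] := @address_lim _ _ _ SY v.
  have [x' [v' [[y [vy _]] vv' _]]] := app m.
  by exists y; exact: address_agree vy.
exists y => //; apply: functional_extensionality_dep => k; apply: contrapT => fyx.
have [U [V [oU oV Uf Vx UV]]] := hausdorff_sep (hX k) fyx.
have ofU : open (f @^-1` [set z : omega_prod X | U (z k)]).
  by apply: open_comp => [z _|]; [exact: cf|exact: open_coord].
have [m1 m1P] := address_nbhs SY vy ofU Uf.
have [m2 m2P] := scheme_shrink (S k) oV Vx.
pose m := (m1 + m2 + k.+1)%N.
have [x' [v' [[y' [vy' fy']] vv' near_x]]] := app m.
have km : (k < m)%N by rewrite leq_addl.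
have [j [sj jx jx']] := near_x k km.
have : (U `&` V) (x' k); last by rewrite UV.
split.
  rewrite -fy'//; apply: m1P; apply: addressW (address_agree vv' vy').
  by rewrite /m -addnA leq_addr.
apply: (m2P j) => //; apply: smallW (S k) _ _ _ _ sj.
by rewrite /m addnAC leq_addl.
Qed.

Theorem theorem1p5 (R : realType) (X : nat -> topologicalType)
    (I : forall n : nat, set (set (X n)))
    (X_polish : forall n : nat, polish R (X n))
    (I_ideal : forall n : nat, sigma_ideal (I n))
    (I_proper : forall n : nat, ~ I n setT)
    (I_Pi11 : forall n : nat, Pi11_on_Sigma11 R (I n))
    (I_closed : forall n : nat, generated_by_closed (I n))
    (A : set (omega_prod X)) (A_analytic : analytic R A) :
  ideal_product I A \/
  exists2 D : set (omega_prod X), positive_Gdelta_cube I D & D `<=` A.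
Proof.
have [Y [pY [f cf <-]]] := A_analytic.
have [BY [smY SY]] := polish_scheme pY.
have ptX n : exists x : X n, True.
  have [x _] := positive_nonempty (I_ideal n) (I_proper n); by exists x.
pose x0 : omega_prod X := fun n => projT1 (cid (ptX n)).
have [|[W winW W0]] := game_dichotomy I_ideal I_proper SY f x0 (fun=> 0%N).
  by left.
right.
pose B n := projT1 (cid (polish_scheme (X_polish n))).
pose sm n := projT1 (cid (projT2 (cid (polish_scheme (X_polish n))))).
have S n : scheme (B n) (sm n) by exact: projT2 (cid (projT2 (cid (polish_scheme (X_polish n))))).
have rep n := positive_rep (S n) (X_polish n) (I_ideal n) (I_Pi11 n).
pose T n := projT1 (cid (rep n)).
have T_local n : tree_local (T n) by have [] := projT2 (cid (rep n)).
have T_spec n k : ~ I n (trace_set (B n) k) <-> exists w, forall m, T n m k w.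
  by have [_] := projT2 (cid (rep n)); apply.
have W_positive n x v : W n x v -> ~ I n (@successors X W n x v).
  by move=> /winW[].
have [G G_fix] := assignment_ex I B sm T W.
pose p0 : state X := (x0, fun _ : nat => 0%N).
have W_start : W 0%N p0.1 p0.2 by [].
exists (local_cube (@cube_section X B W G p0)).
  exact: cube_positive_Gdelta.
move=> x Dx.
apply: (consistent_limit S SY (v := fun k => (code_at B W G p0 k.+1 x).1)) => //.
  by move=> n; exact: polish_hausdorff (X_polish n).
move=> m.
have [p [Wp _ lp ap]] := cube_approx I_ideal S T_local T_spec W_positive G_fix
  W_start m Dx (ltn0Sn m).
exists p.1, p.2; split.
- by have [] := winW _ _ _ Wp.
- exact: lp.
- move=> k km; have [j [sj jx jp]] := ap k km; exists j; split=> //.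
  exact: smallW (S k) _ _ _ (leqnSn m) sj.
Qed.
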